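(* Let $\Omega\subset\mathbb{R}^2$ be measurable and $R>0$. Then for every nonzero $f\in M^1(\mathbb{R})$ $$\frac{\int_{\Omega}|V_{h_0}f(z)|\,dz}{\int_{\mathbb{R}^2}|V_{h_0}f(z)|\,dz}\ \le\ \frac{2\big(1-e^{-\nu(\Omega,R)/2}\big)}{1-e^{-\pi R^2}}.$$
   Context: $h_0(t)=2^{1/4}e^{-\pi t^2}$, $t\in\mathbb{R}$. For $z=(x,\omega)\in\mathbb{R}^2$, $(\pi(z)g)(t)=g(t-x)e^{2\pi i\omega t}$, and the short-time Fourier transform is $V_{g}f(z)=\langle f,\pi(z)g\rangle$. $M^1(\mathbb{R})$ is the modulation space (Feichtinger algebra) of tempered distributions $f$ with $V_{h_0}f\in L^1(\mathbb{R}^2)$. $\nu(\Omega,R)=\sup_{z\in\mathbb{R}^2}|\Omega\cap D_R(z)|$, where $D_R(z)$ is the disk of radius $R$ centered at $z$ and $|\cdot|$ is Lebesgue measure. *)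

(* Defs.v *)
From HB Require Import structures.
From mathcomp Require Import all_boot all_order all_algebra.
From mathcomp Require Export complex.
From mathcomp Require Import all_classical all_reals all_analysis.

Set Implicit Arguments.
Unset Strict Implicit.
Unset Printing Implicit Defensive.

Import Order.TTheory GRing.Theory Num.Theory.
Import numFieldNormedType.Exports.

Local Open Scope classical_set_scope.
Local Open Scope ring_scope.
Local Open Scope complex_scope.

(** [lebesgue_measure] lives on the Borel sets, so the product measure only
    knows the Borel sets of the plane.  [lebesgue2] is its Caratheodory
    completion: its measurable sets are exactly the Lebesgue measurable sets. *)
Definition borel_lebesgue2 (R : realType) :
    {measure set (measurableTypeR R * measurableTypeR R) -> \bar R} :=
  (@lebesgue_measure R \x @lebesgue_measure R)%E.

Definition plane (R : realType) :=
  caratheodory_type ((borel_lebesgue2 R)^*)%mu.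

Definition lebesgue2 (R : realType) : {measure set (plane R) -> \bar R} :=
  @completed_measure_extension _ _ R (borel_lebesgue2 R).

(** The canonical norm on a product type is the max norm, hence the explicit
    Euclidean formula. *)
Definition disk (R : realType) (r : R) (z : plane R) : set (plane R) :=
  [set w | (w.1 - z.1) ^+ 2 + (w.2 - z.2) ^+ 2 < r ^+ 2].

Definition nu (R : realType) (Omega : set (plane R)) (r : R) : \bar R :=
  ereal_sup (range (fun z : plane R => lebesgue2 R (Omega `&` disk r z))).

Definition integrable_C (R : realType) (F : plane R -> R[i]) : Prop :=
  (lebesgue2 R).-integrable setT (fun z => (complex.Re (F z))%:E) /\
  (lebesgue2 R).-integrable setT (fun z => (complex.Im (F z))%:E).

Definition smooth (R : realType) (c : R -> R) : Prop :=
  forall n x, derivable (derive1n n c) x 1.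

Definition derivn_C (R : realType) (n : nat) (phi : R -> R[i]) (t : R) : R[i] :=
  derive1n n (fun s => complex.Re (phi s)) t +i*
  derive1n n (fun s => complex.Im (phi s)) t.

Definition schwartz (R : realType) (phi : R -> R[i]) : Prop :=
  [/\ smooth (fun t => complex.Re (phi t)),
      smooth (fun t => complex.Im (phi t)) &
      forall a b : nat, exists M : R, forall t : R,
        `|t| ^+ a * Normc.normc (derivn_C b phi t) <= M].

(** Finite on Schwartz functions; [sup] of an unbounded set is [0]. *)
Definition schwartz_seminorm (R : realType) (a b : nat) (phi : R -> R[i]) : R :=
  sup (range (fun t : R => `|t| ^+ a * Normc.normc (derivn_C b phi t))).

(** A tempered distribution is a linear functional on the Schwartz space,
    continuous for the topology generated by the Schwartz seminorms.  It is
    represented by a function on all of [R -> R[i]] of which only the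
    restriction to the Schwartz functions matters. *)
Definition tempered (R : realType) (f : (R -> R[i]) -> R[i]) : Prop :=
  (forall (a : R[i]) (phi psi : R -> R[i]), schwartz phi -> schwartz psi ->
     f (fun t => a * phi t + psi t) = a * f phi + f psi) /\
  (exists (M : R) (N : nat), forall phi : R -> R[i], schwartz phi ->
     Normc.normc (f phi) <=
       M * \sum_(a < N.+1) \sum_(b < N.+1) schwartz_seminorm a b phi).

Definition nonzero_distribution (R : realType) (f : (R -> R[i]) -> R[i]) : Prop :=
  exists2 phi : R -> R[i], schwartz phi & f phi != 0.

(** The bracket $\langle f, g\rangle$ extending the inner product of $L^2$: it
    is linear in [f] and antilinear in [g], hence the conjugation, as
    distributions are linear functionals. *)
Definition bracket (R : realType) (f : (R -> R[i]) -> R[i]) (g : R -> R[i]) :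
    R[i] :=
  f (fun t => conjc (g t)).

Definition expi (R : realType) (theta : R) : R[i] := cos theta +i* sin theta.

(** The time-frequency shift $\pi(x, \omega)$; [pi] itself denotes the number. *)
Definition tfshift (R : realType) (z : plane R) (g : R -> R[i]) (t : R) : R[i] :=
  g (t - z.1) * expi (2 * pi * z.2 * t).

Definition stft (R : realType) (g : R -> R[i]) (f : (R -> R[i]) -> R[i])
    (z : plane R) : R[i] :=
  bracket f (tfshift z g).

Definition h0 (R : realType) (t : R) : R[i] :=
  (2 `^ (1 / 4) * expR (- (pi * t ^+ 2)))%:C.

Definition M1 (R : realType) (f : (R -> R[i]) -> R[i]) : Prop :=
  tempered f /\ integrable_C (stft (@h0 R) f).

(* Main.v *)
From HB Require Import structures.
Require Import Defs.
From mathcomp Require Import all_boot all_order all_algebra.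
From mathcomp Require Import all_classical all_reals all_analysis.
From mathcomp Require Import measurable_realfun ring lra zify.
Import Order.TTheory GRing.Theory Num.Theory.
Import numFieldNormedType.Exports.
Local Open Scope classical_set_scope.
Local Open Scope ring_scope.

Set Implicit Arguments.
Unset Strict Implicit.
Unset Printing Implicit Defensive.

(** Write V(z) for the modulus of the short-time Fourier transform of f at z.
    Up to the factor exp(-pi |w|^2 / 2), V is the modulus of an entire function
    of w = x - i omega, and the theorem is a consequence of the mean value
    property of that function.

    Local inequality (stft_submean).  For a function F holomorphic near the
    closed disk of radius r about 0, F(0) (1 - exp(-pi r^2)) is the integral
    of F(v) exp(-pi |v|^2) over the disk.  Applied after recentering at z, it
    gives
      (1 - exp(-pi r^2)) V(z) <= int_{|w-z|<r} V(w) exp(-pi |w-z|^2 / 2) dw.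

    Double counting (concentration).  Integrate this over z in Omega and
    exchange the integrals: V(w) is then multiplied by the integral of
    exp(-pi |z-w|^2 / 2) over z in Omega, |z-w|<r.  That set has measure at
    most nu(Omega, r), and among the sets of measure m the Gaussian has the
    largest integral on a disk centered at w, namely 2 (1 - exp(-m/2))
    (bathtub).  The theorem follows on dividing by the integral of V.

    The mean value identity is needed for polynomials only
    (submean_horner), because f being tempered makes V a uniform limit on
    each disk of moduli of polynomials times a Gaussian (stft_approx).
    Indeed the n-th Taylor remainder in xi of exp(t xi) exp(-pi t^2) is
    O(2^-n) in every Schwartz seminorm, uniformly for xi in a bounded set, so
    the power series obtained by applying f term by term converges to the
    transform.  For polynomials, v^n exp(-pi |v|^2) with n > 0 has integral 0
    on the disk, being up to a constant the d-bar derivative of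
    v^(n-1) (exp(-pi |v|^2) - exp(-pi r^2)), which vanishes on the circle:
    by Fubini this needs nothing beyond the fundamental theorem of calculus on
    each chord (green_horner). *)

(** * Complex exponential and the remainders of its Taylor series *)

Section Complex.
Local Open Scope complex_scope.
Context {R : realType}.
Local Notation C := (complex R).
Local Notation re := (@complex.Re R).
Local Notation im := (@complex.Im R).
Local Notation normc := (@Normc.normc R).
Implicit Types (u v : C) (t : R) (n : nat) (phi psi : R -> C).

Lemma normc_ge0 u : 0 <= normc u.
Proof. by case: u => a b; exact: sqrtr_ge0. Qed.

Lemma normcX u n : normc (u ^+ n) = normc u ^+ n.
Proof.
elim: n => [|n IH]; first by rewrite !expr0 (@Normc.normc1 R).
by rewrite !exprS Normc.normcM IH.
Qed.

Lemma normc_real t : normc t%:C = `|t|.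
Proof. by rewrite /= expr0n/= addr0 sqrtr_sqr. Qed.

Lemma normcB u v : normc (u - v) = normc (v - u).
Proof. by rewrite -normcN opprB. Qed.

Lemma normr_re u : `|re u| <= normc u.
Proof.
by case: u => a b /=; rewrite -(sqrtr_sqr a) ler_wsqrtr// lerDl sqr_ge0.
Qed.

Lemma normr_im u : `|im u| <= normc u.
Proof.
by case: u => a b /=; rewrite -(sqrtr_sqr b) ler_wsqrtr// lerDr sqr_ge0.
Qed.

Lemma normc_le_reim u : normc u <= `|re u| + `|im u|.
Proof.
case: u => a b /=; rewrite -[leRHS]ger0_norm ?addr_ge0// -sqrtr_sqr ler_wsqrtr//.
rewrite -(real_normK (num_real a)) -(real_normK (num_real b)).
by have := mulr_ge0 (normr_ge0 a) (normr_ge0 b); nra.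
Qed.

Lemma normc_dist u v : `|normc u - normc v| <= normc (u - v).
Proof.
have tri a b : normc a <= normc (a - b) + normc b.
  by rewrite -{1}(subrK b a) le_normcD.
by rewrite ler_norml; have := tri u v; have := tri v u; rewrite (normcB v u); lra.
Qed.

Definition cexp u : C :=
  (expR (re u) * cos (im u)) +i* (expR (re u) * sin (im u)).

Lemma cexp0 : cexp 0 = 1.
Proof. by rewrite /cexp /= expR0 cos0 sin0 mul1r mulr0. Qed.

Lemma normc_cexp u : normc (cexp u) = expR (re u).
Proof.
rewrite /cexp /= !exprMn -mulrDr cos2Dsin2 mulr1 sqrtr_sqr.
by rewrite ger0_norm// expR_ge0.
Qed.

Definition exp_tail n u : C := cexp u - \sum_(k < n) (k`!%:R)^-1 * u ^+ k.

Lemma exp_tail0 u : exp_tail 0 u = cexp u.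
Proof. by rewrite /exp_tail big_ord0 subr0. Qed.

Lemma exp_tailS n u : exp_tail n.+1 u = exp_tail n u - (n`!%:R)^-1 * u ^+ n.
Proof. by rewrite /exp_tail big_ord_recr /= opprD addrA. Qed.

(** This is the initial value for the induction on n in the bound below, which
    integrates along the segment from 0 to u. *)
Lemma exp_tailS0 n : exp_tail n.+1 0 = 0.
Proof.
by elim: n => [|n IH]; rewrite exp_tailS ?IH ?exp_tail0 ?cexp0 expr0n/= ?mulr0 ?subr0// fact0 invr1 mul1r subrr.
Qed.

(** Differentiability of a complex function of a real variable is stated on
    real and imaginary parts, the form in which the Schwartz space is defined.
    *)
Definition cderiv phi psi := forall t,
  is_derive t 1 (fun s => re (phi s)) (re (psi t)) /\
  is_derive t 1 (fun s => im (phi s)) (im (psi t)).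

Lemma cderiv_cst u : cderiv (fun=> u) (fun=> 0).
Proof. by move=> t; split; exact: is_derive_cst. Qed.

Lemma cderiv_id : cderiv (fun t => t%:C) (fun=> 1).
Proof. by move=> t; split; [exact: is_derive_id|exact: is_derive_cst]. Qed.

Lemma reD u v : re (u + v) = re u + re v.
Proof. by case: u => a b; case: v. Qed.

Lemma imD u v : im (u + v) = im u + im v.
Proof. by case: u => a b; case: v. Qed.

Lemma reM u v : re (u * v) = re u * re v - im u * im v.
Proof. by case: u => a b; case: v. Qed.

Lemma imM u v : im (u * v) = re u * im v + im u * re v.
Proof. by case: u => a b; case: v. Qed.

Lemma cderivD phi phi' psi psi' : cderiv phi phi' -> cderiv psi psi' ->
  cderiv (fun t => phi t + psi t) (fun t => phi' t + psi' t).
Proof.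
move=> dphi dpsi t; have [p1 p2] := dphi t; have [q1 q2] := dpsi t.
split.
  by under eq_fun do rewrite reD; rewrite reD; exact: (is_deriveD p1 q1).
by under eq_fun do rewrite imD; rewrite imD; exact: (is_deriveD p2 q2).
Qed.

Lemma cderivM phi phi' psi psi' : cderiv phi phi' -> cderiv psi psi' ->
  cderiv (fun t => phi t * psi t) (fun t => phi' t * psi t + phi t * psi' t).
Proof.
move=> dphi dpsi t; have [p1 p2] := dphi t; have [q1 q2] := dpsi t.
split.
  under eq_fun do rewrite reM.
  have := is_deriveB (is_deriveM p1 q1) (is_deriveM p2 q2).
  by move/is_derive_eq; apply; rewrite reD !reM /GRing.scale/=; ring.
under eq_fun do rewrite imM.
have := is_deriveD (is_deriveM p1 q2) (is_deriveM p2 q1).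
by move/is_derive_eq; apply; rewrite imD !imM /GRing.scale/=; ring.
Qed.

Lemma cderiv_eq phi psi psi' : cderiv phi psi -> psi =1 psi' -> cderiv phi psi'.
Proof. by move=> d e t; rewrite -e. Qed.

Lemma cderivZ u phi phi' : cderiv phi phi' ->
  cderiv (fun t => u * phi t) (fun t => u * phi' t).
Proof.
move=> d; apply: cderiv_eq (cderivM (cderiv_cst u) d) _ => t /=.
by rewrite mul0r add0r.
Qed.

Lemma cderivB phi phi' psi psi' : cderiv phi phi' -> cderiv psi psi' ->
  cderiv (fun t => phi t - psi t) (fun t => phi' t - psi' t).
Proof.
move=> dphi dpsi; rewrite (_ : (fun _ => _) = fun t => phi t + (-1) * psi t).
  apply: cderiv_eq (cderivD dphi (cderivZ (-1) dpsi)) _ => t.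
  by rewrite mulN1r.
by apply/funext => t; rewrite mulN1r.
Qed.

Lemma cderiv_lin u : cderiv (fun t => t%:C * u) (fun=> u).
Proof.
apply: cderiv_eq (cderivM cderiv_id (cderiv_cst u)) _ => t /=.
by rewrite mulr0 addr0 mul1r.
Qed.

Lemma cderivX phi phi' n : cderiv phi phi' ->
  cderiv (fun t => phi t ^+ n) (fun t => n%:R * phi' t * phi t ^+ n.-1).
Proof.
move=> d; elim: n => [|n IH].
  rewrite (_ : (fun _ => _) = fun=> 1); last by apply/funext => t; rewrite expr0.
  by apply: cderiv_eq (cderiv_cst 1) _ => t; rewrite !mul0r.
rewrite (_ : (fun _ => _) = fun t => phi t * phi t ^+ n); last first.
  by apply/funext => t; rewrite exprS.
apply: cderiv_eq (cderivM d IH) _ => t /=.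
case: n {IH} => [|n] /=; first by rewrite !mul0r mulr0 addr0 mul1r.
by rewrite exprS [in RHS]mulrS; ring.
Qed.

Lemma cderiv_cexp u :
  cderiv (fun t => cexp (t%:C * u)) (fun t => u * cexp (t%:C * u)).
Proof.
case: u => a b t.
have la c : is_derive t 1 (fun s => s * c) c.
  have := is_deriveM (is_derive_id t 1) (is_derive_cst c t 1).
  by move/is_derive_eq; apply; rewrite /GRing.scale/= mulr0 add0r mulr1.
have da : is_derive t 1 (fun s => expR (s * a)) (expR (t * a) * a).
  exact: is_derive1_comp.
have dc : is_derive t 1 (fun s => cos (s * b)) (- sin (t * b) * b).
  exact: is_derive1_comp.
have ds : is_derive t 1 (fun s => sin (s * b)) (cos (t * b) * b).
  exact: is_derive1_comp.
have e1 s : re (s%:C * (a +i* b)) = s * a by rewrite reM/= mul0r subr0.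
have e2 s : im (s%:C * (a +i* b)) = s * b by rewrite imM/= mul0r addr0.
have ce s : cexp (s%:C * (a +i* b)) =
    (expR (s * a) * cos (s * b)) +i* (expR (s * a) * sin (s * b)).
  by rewrite /cexp e1 e2.
split.
  under eq_fun do rewrite ce.
  have := is_deriveM da dc.
  by move/is_derive_eq; apply; rewrite ce reM /GRing.scale/=; ring.
under eq_fun do rewrite ce.
have := is_deriveM da ds.
by move/is_derive_eq; apply; rewrite ce imM /GRing.scale/=; ring.
Qed.

(** Truncated predecessor is the right one: the remainder of order 0 is the
    exponential itself, which is its own derivative. *)
Lemma cderiv_exp_tail n u :
  cderiv (fun t => exp_tail n (t%:C * u)) (fun t => u * exp_tail n.-1 (t%:C * u)).
Proof.
elim: n => [|n IH].
  rewrite (_ : (fun _ => _) = fun t => cexp (t%:C * u)); last first.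
    by apply/funext => t; rewrite exp_tail0.
  by apply: cderiv_eq (cderiv_cexp u) _ => t; rewrite exp_tail0.
rewrite (_ : (fun _ => _) =
    fun t => exp_tail n (t%:C * u) - (n`!%:R)^-1 * (t%:C * u) ^+ n); last first.
  by apply/funext => t; rewrite exp_tailS.
apply: cderiv_eq (cderivB IH (cderivZ _ (cderivX n (cderiv_lin u)))) _ => t /=.
case: n {IH} => [|n] /=; first by rewrite !mul0r mulr0 subr0.
rewrite exp_tailS [RHS]mulrBr; congr (_ - _).
rewrite factS natrM; have n0 : n.+1%:R != 0 :> C by rewrite pnatr_eq0.
have f0 : n`!%:R != 0 :> C by rewrite pnatr_eq0 -lt0n fact_gt0.
move: (n.+1%:R : C) n0 (n`!%:R : C) f0 => x x0 y y0.
by field; rewrite x0 y0.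
Qed.

(** The difference B exp(k t) - F(t) is nondecreasing. *)
Lemma growth_bound (F F' : R -> R) (k B : R) : 0 <= B -> 0 <= k -> F 0 = 0 ->
  (forall t, is_derive t 1 F (F' t)) ->
  (forall t, 0 <= t -> F' t <= k * B * expR (k * t)) -> F 1 <= B * expR k.
Proof.
move=> B0 k0 F0 dF leF.
pose G t := B * expR (k * t) - F t.
have dG t : is_derive t 1 G (k * B * expR (k * t) - F' t).
  have lk : is_derive t 1 (fun s => k * s) k.
    have := is_deriveZ k (is_derive_id t (1:R)).
    by move/is_derive_eq; apply; rewrite /GRing.scale/= mulr1.
  have de : is_derive t 1 (fun s => expR (k * s)) (expR (k * t) * k).
    exact: is_derive1_comp.
  have := is_deriveB (is_deriveZ B de) (dF t).
  by move/is_derive_eq; apply; rewrite /GRing.scale/=; ring.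
have : G 0 <= G 1.
  apply: (@ger0_derive1_le_cc R G 0 1) => //.
  - move=> x; rewrite in_itv/= => /andP[x0 _].
    have [_ /= dx] := dG x.
    by rewrite derive1E dx subr_ge0 leF// ltW.
  - apply: derivable_within_continuous => x _; by have := dG x => -[].
  - by rewrite in_itv/= lexx ler01.
  - by rewrite in_itv/= lexx ler01.
rewrite /G F0 mulr0 expR0 !mulr1; lra.
Qed.

(** The bound is geometric in n rather than factorial, at the price of a
    larger exponent. It is proved along the segment from 0 to u: each
    integration of 2^-n exp(4 |u| t) against |u| gains a factor 1/4, and half
    of it is lost in bounding the modulus by the real and imaginary parts. *)
Lemma exp_tail_bound n u : normc (exp_tail n u) <= 2 ^- n * expR (4 * normc u).
Proof.
elim: n u => [|n IH] u.
  rewrite exp_tail0 normc_cexp expr0 invr1 mul1r ler_expR.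
  have := normr_re u; have := ler_norm (re u); have := normc_ge0 u; lra.
(* Stated for a real function, to be applied to the real and imaginary parts of
   t |-> exp_tail n.+1 (t u) on [0, 1]. *)
have key (G G' : R -> R) : G 0 = 0 -> (forall t, is_derive t 1 G (G' t)) ->
    (forall t, 0 <= t -> `|G' t| <= normc (u * exp_tail n (t%:C * u))) ->
    `|G 1| <= 2 ^- n / 4 * expR (4 * normc u).
  move=> G0 dG leG.
  have B0 : 0 <= 2 ^- n / 4 :> R by rewrite divr_ge0// invr_ge0 exprn_ge0.
  have k0 : 0 <= 4 * normc u by rewrite mulr_ge0 ?normc_ge0.
  have G'le t : 0 <= t ->
      `|G' t| <= 4 * normc u * (2 ^- n / 4) * expR (4 * normc u * t).
    move=> t0; apply: le_trans (leG _ t0) _; rewrite Normc.normcM.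
    have := IH (t%:C * u); rewrite Normc.normcM normc_real (ger0_norm t0).
    rewrite (_ : 4 * (t * normc u) = 4 * normc u * t); last by ring.
    move=> /(ler_wpM2l (normc_ge0 u)) /le_trans; apply.
    by rewrite le_eqVlt; apply/orP; left; apply/eqP; field.
  rewrite ler_norml; apply/andP; split; last first.
    apply: (growth_bound B0 k0 G0 dG) => t t0.
    exact: le_trans (ler_norm _) (G'le t t0).
  rewrite lerNl.
  apply: (@growth_bound (fun t => - G t) (fun t => - G' t)) => //.
  - by rewrite G0 oppr0.
  - move=> t t0; apply: le_trans (G'le t t0).
    by rewrite -normrN; exact: ler_norm.
have d := cderiv_exp_tail n.+1 u.
have {}key : `|re (exp_tail n.+1 u)| <= 2 ^- n / 4 * expR (4 * normc u) /\
             `|im (exp_tail n.+1 u)| <= 2 ^- n / 4 * expR (4 * normc u).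
  split.
    have := key (fun t => re (exp_tail n.+1 (t%:C * u)))
      (fun t => re (u * exp_tail n (t%:C * u))).
    rewrite mul1r; apply; first by rewrite mul0r exp_tailS0.
      by move=> t; have [] := d t.
    by move=> t _; exact: normr_re.
  have := key (fun t => im (exp_tail n.+1 (t%:C * u)))
    (fun t => im (u * exp_tail n (t%:C * u))).
  rewrite mul1r; apply; first by rewrite mul0r exp_tailS0.
    by move=> t; have [] := d t.
  by move=> t _; exact: normr_im.
apply: le_trans (normc_le_reim _) _.
apply: le_trans (lerD key.1 key.2) _.
rewrite -mulrDl exprS invfM; apply: ler_wpM2r; first exact: expR_ge0.
rewrite le_eqVlt; apply/orP; left; apply/eqP; field.
by rewrite expf_neq0.
Qed.

End Complex.

(** * Schwartz functions of Gaussian type *)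

Section Schwartz.
Local Open Scope complex_scope.
Context {R : realType}.
Local Notation C := (complex R).
Local Notation re := (@complex.Re R).
Local Notation im := (@complex.Im R).
Local Notation normc := (@Normc.normc R).
Implicit Types (t : R) (n : nat) (phi psi : R -> C).

Lemma derive1n_chain (G : nat -> R -> R) :
  (forall n t, is_derive t 1 (G n) (G n.+1 t)) ->
  forall n, derive1n n (G 0%N) = G n.
Proof.
move=> dG; elim=> [|n IH]; first by rewrite derive1n0.
rewrite derive1nS IH; apply/funext => t.
by rewrite derive1E; have [_] := dG n t.
Qed.

(** A chain lists a function and all its successive derivatives; exhibiting
    one spares any computation with iterated derivatives. *)
Definition cderiv_chain (F : nat -> R -> C) := forall n, cderiv (F n) (F n.+1).

Lemma derive1n_re_chain F : cderiv_chain F ->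
  forall n, derive1n n (fun s => re (F 0%N s)) = fun s => re (F n s).
Proof.
by move=> dF; apply: (@derive1n_chain (fun n s => re (F n s))) => n t; have [] := dF n t.
Qed.

Lemma derive1n_im_chain F : cderiv_chain F ->
  forall n, derive1n n (fun s => im (F 0%N s)) = fun s => im (F n s).
Proof.
by move=> dF; apply: (@derive1n_chain (fun n s => im (F n s))) => n t; have [] := dF n t.
Qed.

Lemma derivn_C_chain F : cderiv_chain F ->
  forall n t, derivn_C n (F 0%N) t = F n t.
Proof.
move=> dF n t; rewrite /derivn_C derive1n_re_chain// derive1n_im_chain//.
by case: (F n t).
Qed.

Lemma schwartz_chain F : cderiv_chain F ->
  (forall a b, exists M, forall t, `|t| ^+ a * normc (F b t) <= M) ->
  schwartz (F 0%N).
Proof.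
move=> dF bF; split.
- by move=> n t; rewrite derive1n_re_chain//; have [[]] := dF n t.
- by move=> n t; rewrite derive1n_im_chain//; have [_ []] := dF n t.
- move=> a b; have [M leM] := bF a b; exists M => t.
  by rewrite derivn_C_chain.
Qed.

Lemma schwartz_seminorm_chain F a b M : cderiv_chain F ->
  (forall t, `|t| ^+ a * normc (F b t) <= M) ->
  schwartz_seminorm a b (F 0%N) <= M.
Proof.
move=> dF leM; apply: ge_sup; first exact: image_nonempty (ex_intro _ 0 I).
by move=> _ [t _ <-]; rewrite derivn_C_chain.
Qed.

(** Finitely many seminorms control a tempered distribution, and the double
    sum over them is replaced by a uniform bound. The constant M in the
    definition has no sign, whence the absolute value. *)
Lemma tempered_bound f : tempered f -> exists K N, 0 <= K /\
  forall phi (X : R), schwartz phi -> 0 <= X ->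
    (forall a b, (a <= N)%N -> (b <= N)%N -> schwartz_seminorm a b phi <= X) ->
    normc (f phi) <= K * X.
Proof.
move=> [_ [M [N leM]]]; exists (`|M| * (N.+1 * N.+1)%:R), N; split.
  by rewrite mulr_ge0.
move=> phi X sphi X0 leX; apply: le_trans (leM _ sphi) _.
have s0 : 0 <= \sum_(a < N.+1) \sum_(b < N.+1) schwartz_seminorm a b phi.
  apply: sumr_ge0 => a _; apply: sumr_ge0 => b _.
  have [_ _ /(_ a b)[B leB]] := sphi.
  apply: (@le_trans _ _ (`|0 : R| ^+ a * normc (derivn_C b phi 0))).
    by rewrite mulr_ge0 ?exprn_ge0 ?normc_ge0.
  by apply: ub_le_sup; [exists B => _ [t _ <-]|exists 0].
apply: (@le_trans _ _ (`|M| * \sum_(a < N.+1) \sum_(b < N.+1) X)).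
  apply: le_trans (ler_wpM2r s0 (ler_norm M)) _; apply: ler_wpM2l => //.
  apply: ler_sum => a _; apply: ler_sum => b _.
  exact: leX (leq_ord a) (leq_ord b).
rewrite -mulrA ler_wpM2l//.
under eq_bigr do rewrite sumr_const card_ord -mulr_natl.
by rewrite sumr_const card_ord -[leLHS]mulr_natl mulrA natrM.
Qed.

(** The b-th derivative of u_i g_j for two chains u and g, expanded by the
    product rule without collecting the binomial coefficients. *)
Fixpoint leibniz (u g : nat -> R -> C) (b i j : nat) (t : R) : C :=
  if b is b'.+1 then leibniz u g b' i.+1 j t + leibniz u g b' i j.+1 t
  else u i t * g j t.

Lemma cderiv_leibniz u g b i j : cderiv_chain u -> cderiv_chain g ->
  cderiv (leibniz u g b i j) (leibniz u g b.+1 i j).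
Proof.
move=> du dg; elim: b i j => [|b IH] i j; first exact: cderivM.
exact: cderivD.
Qed.

Lemma leibniz_bound u g N a (A B : R) t : 0 <= A -> 0 <= B ->
  (forall i, (i <= N)%N -> normc (u i t) <= A) ->
  (forall j, (j <= N)%N -> `|t| ^+ a * normc (g j t) <= B) ->
  forall b i j, (b + i <= N)%N -> (b + j <= N)%N ->
  `|t| ^+ a * normc (leibniz u g b i j t) <= 2 ^+ b * (A * B).
Proof.
move=> A0 B0 leA leB; elim=> [|b IH] i j /=; rewrite ?add0n ?addSn => iN jN.
  rewrite Normc.normcM mulrCA expr0 mul1r; apply: ler_pM.
  - exact: normc_ge0.
  - by rewrite mulr_ge0 ?exprn_ge0 ?normc_ge0.
  - exact: leA.
  - exact: leB.
apply: le_trans (ler_wpM2l (exprn_ge0 _ (normr_ge0 _)) (le_normcD _ _)) _.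
rewrite mulrDr exprS -mulrA mulr_natl mulr2n.
by apply: lerD; apply: IH; rewrite ?addnS// ltnW.
Qed.

(** Hermite polynomials up to normalization: the factor of exp(-pi t^2) in its
    j-th derivative. *)
Fixpoint gauss_poly j : {poly R} :=
  if j is j'.+1 then (gauss_poly j')^`() - (2 * pi) *: ('X * gauss_poly j') else 1.

Definition gauss_deriv j t : C := ((gauss_poly j).[t] * expR (- (pi * t ^+ 2)))%:C.

Lemma cderiv_chain_gauss_deriv : cderiv_chain gauss_deriv.
Proof.
move=> j t; split; last exact: is_derive_cst.
have d2 : is_derive t 1 (fun s : R => - (pi * s ^+ 2)) (- (pi * (2 * t))).
  have -> : (fun s : R => - (pi * s ^+ 2)) = (fun s : R => - (pi * (s * s))).
    by apply/funext => s; rewrite expr2.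
  have dd := is_deriveM (is_derive_id t (1 : R)) (is_derive_id t (1 : R)).
  have := is_deriveN (is_deriveZ pi dd).
  by move/is_derive_eq; apply; rewrite /GRing.scale/=; ring.
have de : is_derive t 1 (fun s => expR (- (pi * s ^+ 2)))
    (expR (- (pi * t ^+ 2)) * - (pi * (2 * t))).
  exact: is_derive1_comp.
have := is_deriveM (is_derive_poly (gauss_poly j) t) de.
move/is_derive_eq; apply; rewrite /GRing.scale/= !hornerE /GRing.scale/=; ring.
Qed.

Lemma poly_exp_bound (p : {poly R}) : exists K m : R, [/\ 0 <= K, 0 <= m &
  forall t, `|p.[t]| <= K * expR (m * `|t|)].
Proof.
elim/poly_ind: p => [|p c [K [m [K0 m0 Km]]]].
  by exists 0, 0; split => // t; rewrite horner0 normr0 mul0r.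
exists (K + `|c|), (m + 1); split; rewrite ?addr_ge0// => t.
rewrite hornerMXaddC mulrDl; apply: le_trans (ler_normD _ _) (lerD _ _).
  rewrite normrM mulrDl expRD mul1r mulrA; apply: ler_pM => //.
  by apply: le_trans (expR_ge1Dx _); rewrite lerDr.
rewrite -[leLHS]mulr1 ler_wpM2l//.
by rewrite -(@expR0 R) ler_expR mulr_ge0 ?addr_ge0.
Qed.

(** If p is O(exp(m |t|)), use (m + l) |t| - pi t^2 <= (m + l)^2, as pi >= 1. *)
Lemma poly_gauss_bound (p : {poly R}) (l : R) : exists2 K : R, 0 <= K &
  forall t, `|p.[t]| * expR (- (pi * t ^+ 2)) <= K * expR (- (l * `|t|)).
Proof.
have [K [m [K0 m0 Km]]] := poly_exp_bound p.
exists (K * expR ((m + l) ^+ 2)); first by rewrite mulr_ge0 ?expR_ge0.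
move=> t; apply: le_trans (ler_wpM2r (expR_ge0 _) (Km t)) _.
rewrite -!mulrA ler_wpM2l// -!expRD ler_expR.
have := pi_ge2 R; have := real_normK (num_real t); have := sqr_ge0 (m + l - `|t|).
have := sqr_ge0 (m + l); have := sqr_ge0 t.
nra.
Qed.

Lemma gauss_bound N (l : R) : exists2 K : R, 0 <= K & forall a j t,
  (a <= N)%N -> (j <= N)%N -> `|t| ^+ a * normc (gauss_deriv j t) <= K * expR (- (l * `|t|)).
Proof.
have /choice[K HK] : forall c : nat * nat, exists K : R, 0 <= K /\ forall t,
    `|t| ^+ c.1 * normc (gauss_deriv c.2 t) <= K * expR (- (l * `|t|)).
  move=> [a j]; have [K K0 leK] := poly_gauss_bound ('X^a * gauss_poly j) l.
  exists K; split=> // t; apply: le_trans (leK t).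
  rewrite /gauss_deriv normc_real normrM hornerM hornerXn normrM normrX.
  by rewrite (ger0_norm (expR_ge0 _)) mulrA.
exists (\sum_(a < N.+1) \sum_(j < N.+1) K (val a, val j)).
  by apply: sumr_ge0 => a _; apply: sumr_ge0 => j _; have [] := HK (val a, val j).
move=> a j t aN jN; have [_ /(_ t)/= /le_trans] := HK (a, j); apply.
apply: ler_wpM2r; first exact: expR_ge0.
have {}aN : (a < N.+1)%N by [].
have {}jN : (j < N.+1)%N by [].
rewrite (bigD1 (Ordinal aN))//= (bigD1 (Ordinal jN))//= -addrA lerDl addr_ge0//.
  by apply: sumr_ge0 => i _; have [] := HK (a, val i).
by apply: sumr_ge0 => b _; apply: sumr_ge0 => i _; have [] := HK (val b, val i).
Qed.

(** Derivatives of the Gaussian beat any exponential growth, so multiplying it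
    by a function whose derivatives are at most e exp(l |t|) gives seminorms
    at most K e, with K depending on N and l only. *)
Lemma chain_gauss_seminorm N (l : R) : exists2 K : R, 0 <= K &
  forall u, cderiv_chain u -> forall e, 0 <= e ->
  (forall i t, (i <= N)%N -> normc (u i t) <= e * expR (l * `|t|)) ->
  forall a b t, (a <= N)%N -> (b <= N)%N ->
  `|t| ^+ a * normc (leibniz u gauss_deriv b 0 0 t) <= K * e.
Proof.
have [K K0 HK] := gauss_bound N l.
exists (2 ^+ N * K); first by rewrite mulr_ge0 ?exprn_ge0.
move=> u du e e0 leu a b t aN bN.
have := leibniz_bound (mulr_ge0 e0 (expR_ge0 (l * `|t|)))
  (mulr_ge0 K0 (expR_ge0 (- (l * `|t|))))
  (fun i iN => leu i t iN) (fun j jN => HK a j t aN jN).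
move=> /(_ b 0 0)%N; rewrite addn0 => /(_ bN bN) /le_trans; apply.
rewrite [X in _ * X](_ : _ = e * K); last first.
  by rewrite mulrACA -expRD subrr expR0 mulr1.
rewrite -mulrA [e * K]mulrC ler_wpM2r ?mulr_ge0//.
by rewrite ler_weXn2l// ler1n.
Qed.

Lemma schwartz_chain_gauss u : cderiv_chain u ->
  (forall N, exists e l : R, 0 <= e /\
    forall i t, (i <= N)%N -> normc (u i t) <= e * expR (l * `|t|)) ->
  schwartz (fun t => u 0%N t * gauss_deriv 0 t).
Proof.
move=> du bu.
apply: (@schwartz_chain (fun b => leibniz u gauss_deriv b 0 0)).
  by move=> b; exact: cderiv_leibniz cderiv_chain_gauss_deriv.
move=> a b; have [e [l [e0 leu]]] := bu (maxn a b).
have [K K0 HK] := chain_gauss_seminorm (maxn a b) l.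
by exists (K * e) => t; apply: HK; rewrite // ?leq_maxl ?leq_maxr.
Qed.

(** This is the continuity of f on multiples of the Gaussian, in the
    quantitative form that makes the Taylor remainders tend to 0. *)
Lemma tempered_chain_gauss f (l : R) : tempered f -> exists N (K : R), 0 <= K /\
  forall u, cderiv_chain u -> forall e, 0 <= e ->
  (forall i t, (i <= N)%N -> normc (u i t) <= e * expR (l * `|t|)) ->
  schwartz (fun t => u 0%N t * gauss_deriv 0 t) ->
  normc (f (fun t => u 0%N t * gauss_deriv 0 t)) <= K * e.
Proof.
move=> tf; have [M [N [M0 HM]]] := tempered_bound tf.
have [K K0 HK] := chain_gauss_seminorm N l.
exists N, (M * K); split; first by rewrite mulr_ge0.
move=> u du e e0 leu su; rewrite -mulrA; apply: HM => //.
  by rewrite mulr_ge0.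
move=> a b aN bN.
apply: (@schwartz_seminorm_chain (fun b => leibniz u gauss_deriv b 0 0)).
  by move=> c; exact: cderiv_leibniz cderiv_chain_gauss_deriv.
by move=> t; exact: HK.
Qed.

End Schwartz.

(** * The short-time Fourier transform as an entire function *)

Section STFT.
Local Open Scope complex_scope.
Context {R : realType}.
Local Notation C := (complex R).
Local Notation re := (@complex.Re R).
Local Notation im := (@complex.Im R).
Local Notation normc := (@Normc.normc R).
Implicit Types (t r e : R) (n k : nat) (xi : C).

(** Derivatives in t of the n-th Taylor remainder at t xi; once i exceeds n
    the truncated subtraction leaves the exponential. *)
Definition exp_tail_chain n xi i t : C := xi ^+ i * exp_tail (n - i) (t%:C * xi).

Lemma cderiv_exp_tail_chain n xi : cderiv_chain (exp_tail_chain n xi).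
Proof.
move=> i; apply: cderiv_eq (cderivZ _ (cderiv_exp_tail (n - i) xi)) _ => t.
by rewrite /exp_tail_chain exprSr subnS mulrA.
Qed.

(** Each derivative costs a factor 2 r; the order N is fixed by f while n
    tends to infinity. *)
Lemma exp_tail_chain_bound n xi r N i t : 1 <= r -> normc xi <= r -> (i <= N)%N ->
  normc (exp_tail_chain n xi i t) <= (2 * r) ^+ N * 2 ^- n * expR (4 * r * `|t|).
Proof.
move=> r1 xir iN; rewrite /exp_tail_chain Normc.normcM normcX.
have r0 : 0 <= r by lra.
have xi0 := normc_ge0 xi.
rewrite [leRHS](_ : _ = r ^+ N * (2 ^+ N * 2 ^- n * expR (4 * r * `|t|))).
  2: by rewrite exprMn; ring.
apply: ler_pM.
- by rewrite exprn_ge0.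
- exact: normc_ge0.
- apply: (@le_trans _ _ (r ^+ i)); first by rewrite lerXn2r// nnegrE.
  exact: ler_weXn2l.
- apply: le_trans (exp_tail_bound _ _) _.
  apply: ler_pM.
  + by rewrite invr_ge0 exprn_ge0.
  + exact: expR_ge0.
  + rewrite ler_pdivlMr ?exprn_gt0// mulrC ler_pdivrMr ?exprn_gt0// -exprD.
    by rewrite ler_weXn2l// ?ler1n//; lia.
  + rewrite ler_expR Normc.normcM normc_real -!mulrA ler_wpM2l// mulrC.
    exact: ler_wpM2r.
Qed.

Lemma schwartz_exp_tail_gauss n xi :
  schwartz (fun t => exp_tail n (t%:C * xi) * gauss_deriv 0 t).
Proof.
have -> : (fun t => exp_tail n (t%:C * xi) * gauss_deriv 0 t) =
          (fun t => exp_tail_chain n xi 0 t * gauss_deriv 0 t).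
  by apply/funext => t; rewrite /exp_tail_chain expr0 mul1r subn0.
apply: schwartz_chain_gauss; first exact: cderiv_exp_tail_chain.
move=> N; pose r := normc xi + 1.
have r1 : 1 <= r by rewrite lerDr normc_ge0.
exists ((2 * r) ^+ N * 2 ^- n), (4 * r); split.
  by rewrite mulr_ge0 ?invr_ge0 ?exprn_ge0//; lra.
by move=> i t iN; apply: exp_tail_chain_bound; rewrite // lerDl.
Qed.

Definition monomial k t : C := (k`!%:R)^-1 * t%:C ^+ k.

Lemma exp_tail_monomial k xi t :
  exp_tail k (t%:C * xi) = xi ^+ k * monomial k t + exp_tail k.+1 (t%:C * xi).
Proof. by rewrite exp_tailS /monomial exprMn; ring. Qed.

(** The normalized monomial is the difference of two consecutive remainders at
    xi = 1, so the chains already built apply. *)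
Lemma schwartz_monomial_gauss k : schwartz (fun t => monomial k t * gauss_deriv 0 t).
Proof.
pose u i t : C := exp_tail_chain k 1 i t - exp_tail_chain k.+1 1 i t.
have -> : (fun t => monomial k t * gauss_deriv 0 t) = (fun t => u 0%N t * gauss_deriv 0 t).
  apply/funext => t; rewrite /u /exp_tail_chain !expr0 !mul1r !subn0.
  by rewrite exp_tail_monomial expr1n mul1r addrK.
apply: schwartz_chain_gauss.
  by move=> i; apply: cderivB; exact: cderiv_exp_tail_chain.
move=> N.
exists ((2 * 1) ^+ N * 2 ^- k + (2 * 1) ^+ N * 2 ^- k.+1), (4 * 1); split.
  by rewrite addr_ge0// mulr_ge0 ?invr_ge0 ?exprn_ge0//; lra.
move=> i t iN; rewrite mulrDl.
apply: le_trans (le_normcD _ _) _; rewrite normcN.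
by apply: lerD; apply: exp_tail_chain_bound; rewrite // Normc.normc1.
Qed.

Context (f : (R -> C) -> C) (tf : tempered f).

Definition moment k := f (fun t => monomial k t * gauss_deriv 0 t).

(** Up to an explicit factor this is the Bargmann transform of f, an entire
    function of xi. *)
Definition bargmann xi := f (fun t => cexp (t%:C * xi) * gauss_deriv 0 t).

(** Linearity of f only applies to Schwartz functions, so the terms of the
    Taylor series are split off one at a time. *)
Lemma bargmann_exp_tail n xi : bargmann xi =
  \sum_(k < n) xi ^+ k * moment k +
  f (fun t => exp_tail n (t%:C * xi) * gauss_deriv 0 t).
Proof.
elim: n => [|n IH].
  rewrite big_ord0 add0r /bargmann; congr f.
  by apply/funext => t; rewrite exp_tail0.
rewrite IH big_ord_recr /= -addrA; congr (_ + _).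
rewrite /moment -(tf.1 _ _ _ (schwartz_monomial_gauss n) (schwartz_exp_tail_gauss n.+1 xi)).
by congr f; apply/funext => t; rewrite (exp_tail_monomial n) [LHS]mulrDl mulrA.
Qed.

Lemma bargmann_approx r : exists2 K : R, 0 <= K & forall n xi, normc xi <= r ->
  normc (bargmann xi - \sum_(k < n) xi ^+ k * moment k) <= K * 2 ^- n.
Proof.
pose r1 := Num.max 1 r.
have r11 : 1 <= r1 by rewrite le_max lexx.
have [N [K [K0 HK]]] := tempered_chain_gauss (4 * r1) tf.
exists (K * (2 * r1) ^+ N).
  by rewrite mulr_ge0// exprn_ge0//; lra.
move=> n xi xir; rewrite (bargmann_exp_tail n xi) addrAC subrr add0r -mulrA.
have -> : (fun t => exp_tail n (t%:C * xi) * gauss_deriv 0 t) =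
          (fun t => exp_tail_chain n xi 0 t * gauss_deriv 0 t).
  by apply/funext => t; rewrite /exp_tail_chain expr0 mul1r subn0.
apply: HK.
- exact: cderiv_exp_tail_chain.
- by rewrite mulr_ge0 ?invr_ge0 ?exprn_ge0//; lra.
- move=> i t iN; apply: exp_tail_chain_bound => //.
  by rewrite (le_trans xir)// le_max lexx orbT.
- have := schwartz_exp_tail_gauss n xi; congr schwartz.
  by apply/funext => t; rewrite /exp_tail_chain expr0 mul1r subn0.
Qed.

Lemma distribution_scale (a : C) phi : schwartz phi ->
  f (fun t => a * phi t) = a * f phi.
Proof.
move=> sphi; have := tf.1 (a - 1) _ _ sphi sphi.
rewrite mulrBl mul1r subrK => <-; congr f; apply/funext => t.
by rewrite mulrBl mul1r subrK.
Qed.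

(** The modulus of the transform is thus explicit times the modulus of an
    entire function of x - i omega. *)
Lemma stftE (z : plane R) : stft (@h0 R) f z =
  (2 `^ (1 / 4) * expR (- (pi * z.1 ^+ 2)))%:C *
  bargmann ((2 * pi)%:C * (z.1 -i* z.2)).
Proof.
have s := schwartz_exp_tail_gauss 0 ((2 * pi)%:C * (z.1 -i* z.2)).
rewrite /bargmann /stft /bracket.
have -> : (fun t => cexp (t%:C * ((2 * pi)%:C * (z.1 -i* z.2))) * gauss_deriv 0 t) =
  (fun t => exp_tail 0 (t%:C * ((2 * pi)%:C * (z.1 -i* z.2))) * gauss_deriv 0 t).
  by apply/funext => t; rewrite exp_tail0.
rewrite -distribution_scale//; congr f; apply/funext => t.
rewrite /tfshift /h0 /expi /gauss_deriv /= hornerC mul1r exp_tail0 /cexp /=.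
rewrite !(mul0r, mulr0, subr0, addr0, add0r, sub0r).
have -> : expR (- (pi * (t - z.1) ^+ 2)) = expR (- (pi * z.1 ^+ 2)) *
    expR (t * (2 * pi * z.1)) * expR (- (pi * t ^+ 2)).
  by rewrite -!expRD; congr expR; ring.
have -> : t * (2 * pi * - z.2) = - (2 * pi * z.2 * t) by ring.
by rewrite cosN sinN; congr Complex; ring.
Qed.

End STFT.

Section Approx.
Local Open Scope complex_scope.
Context {R : realType}.
Local Notation C := (complex R).
Local Notation re := (@complex.Re R).
Local Notation im := (@complex.Im R).
Local Notation normc := (@Normc.normc R).
Implicit Types (r e : R) (F G : C -> C) (u v : C).

(** Uniform approximability by polynomials on a disk, which stands for
    holomorphy on a neighborhood of it. *)
Definition poly_approx r F := forall e, 0 < e ->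
  exists Q : {poly C}, forall v, normc v <= r -> normc (F v - Q.[v]) <= e.

Lemma poly_bounded r (Q : {poly C}) :
  exists2 B : R, 0 <= B & forall v, normc v <= r -> normc Q.[v] <= B.
Proof.
elim/poly_ind: Q => [|Q c [B B0 leB]].
  by exists 0 => // v _; rewrite horner0 Normc.normc0.
exists (B * `|r| + normc c); first by rewrite addr_ge0 ?mulr_ge0 ?normc_ge0.
move=> v vr; rewrite hornerMXaddC; apply: le_trans (le_normcD _ _) _.
rewrite lerD2r Normc.normcM; apply: ler_pM; rewrite ?normc_ge0 ?leB//.
exact: le_trans vr (ler_norm _).
Qed.

(** Bounded uniform limits of polynomials are stable under products; the
    tolerances are chosen with respect to a bound of F, then of the
    approximant Q of G. *)
Lemma poly_approxM r F G : poly_approx r F -> poly_approx r G ->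
  poly_approx r (fun v => F v * G v).
Proof.
move=> aF aG e e0.
have [P0 HP0] := aF 1 ltr01; have [B B0 HB] := poly_bounded r P0.
have F_le v : normc v <= r -> normc (F v) <= 1 + B.
  move=> vr; rewrite -(subrK P0.[v] (F v)); apply: le_trans (le_normcD _ _) _.
  by apply: lerD; [exact: HP0|exact: HB].
have [Q HQ] := aG (e / (2 * (1 + B))) ltac:(by rewrite divr_gt0//; lra).
have [D D0 HD] := poly_bounded r Q.
have [P HP] := aF (e / (2 * (1 + D))) ltac:(by rewrite divr_gt0//; lra).
exists (P * Q) => v vr; rewrite hornerM.
rewrite (_ : _ - _ = F v * (G v - Q.[v]) + (F v - P.[v]) * Q.[v]); last by ring.
apply: le_trans (le_normcD _ _) _; rewrite !Normc.normcM.
rewrite [e]splitr; apply: lerD.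
  have -> : e / 2 = (1 + B) * (e / (2 * (1 + B))) by field; lra.
  by apply: ler_pM; rewrite ?normc_ge0 ?F_le ?HQ.
apply: (@le_trans _ _ (e / (2 * (1 + D)) * (1 + D))); last first.
  by rewrite le_eqVlt; apply/orP; left; apply/eqP; field; lra.
apply: ler_pM; rewrite ?normc_ge0 ?HP//.
by apply: le_trans (HD _ vr) _; rewrite lerDr.
Qed.

Lemma small_pow2 (K e : R) : 0 <= K -> 0 < e -> exists n, K * 2 ^- n <= e.
Proof.
move=> K0 e0; exists (Num.bound (K / e)).
have := archi_boundP (divr_ge0 K0 (ltW e0)); set n := Num.bound _ => Ke.
rewrite ler_pdivrMr ?exprn_gt0// mulrC -ler_pdivrMr//.
apply: ltW; apply: lt_le_trans Ke _; rewrite -natrX ler_nat.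
by rewrite ltnW// ltn_expl.
Qed.

Lemma poly_approx_cexp r (q : {poly C}) : poly_approx r (fun v => cexp q.[v]).
Proof.
move=> e e0; have [B B0 HB] := poly_bounded r q.
have [n Hn] := small_pow2 (expR_ge0 (4 * B)) e0.
exists (\sum_(k < n) (k`!%:R)^-1 *: q ^+ k) => v vr.
rewrite horner_sum; under eq_bigr do rewrite hornerZ horner_exp.
apply: le_trans (exp_tail_bound n q.[v]) _; apply: le_trans Hn.
rewrite mulrC ler_wpM2r ?invr_ge0 ?exprn_ge0// ler_expR ler_wpM2l//.
exact: HB.
Qed.

Lemma poly_approx_bargmann f r (q : {poly C}) : tempered f ->
  poly_approx r (fun v => bargmann f q.[v]).
Proof.
move=> tf e e0; have [B B0 HB] := poly_bounded r q.
have [K K0 HK] := bargmann_approx tf B.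
have [n Hn] := small_pow2 K0 e0.
exists (\sum_(k < n) moment f k *: q ^+ k) => v vr.
rewrite horner_sum; under eq_bigr do rewrite hornerZ horner_exp mulrC.
by apply: le_trans Hn; exact: HK (HB _ vr).
Qed.

Lemma poly_approx_poly r (q : {poly C}) : poly_approx r (horner q).
Proof. by move=> e e0; exists q => v _; rewrite subrr Normc.normc0 ltW. Qed.

(** Recentering at z multiplies the entire function by exp(-2 pi x_z v - pi
    v^2 / 2), v being the complex coordinate of w relative to z; this factor
    is zero free and turns the weight exp(-pi x^2) into exp(-pi |v|^2 / 2) up
    to a constant. *)
Lemma stft_approx f (z : plane R) (r e : R) : tempered f -> 0 < r -> 0 < e ->
  exists Q : {poly C}, forall w : plane R, disk r z w ->
    `|normc (stft (@h0 R) f w) -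
      normc Q.[(w.1 - z.1) -i* (w.2 - z.2)] *
      expR (- (pi / 2 * ((w.1 - z.1) ^+ 2 + (w.2 - z.2) ^+ 2)))| <= e.
Proof.
move=> tf r0 e0.
pose A0 : C := (2 `^ (1 / 4) * expR (- (pi * z.1 ^+ 2)))%:C.
pose q1 : {poly C} := (2 * pi)%:C *: ('X + (z.1 -i* z.2)%:P).
(* A0, q1 and q2 are the constant, the argument of the entire function and the
   exponent of the zero free factor, as polynomials in v = w - z. *)
pose q2 : {poly C} := - ((2 * pi * z.1)%:C *: 'X + (pi / 2)%:C *: 'X^2).
have := poly_approxM (poly_approx_poly r A0%:P)
  (poly_approxM (poly_approx_bargmann r q1 tf) (poly_approx_cexp r q2)).
move=> /(_ e e0)[Q HQ]; exists Q => w.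
rewrite /disk/=; set p := w.1 - z.1; set s := w.2 - z.2 => zw.
have vr : normc (p -i* s) <= r.
  by rewrite /= sqrrN -(ger0_norm (ltW r0)) -sqrtr_sqr ler_wsqrtr// ltW.
have := HQ _ vr; set H := (X in X - _).
have -> : normc (stft (@h0 R) f w) =
    normc H * expR (- (pi / 2 * (p ^+ 2 + s ^+ 2))).
  rewrite stftE// /H hornerC !Normc.normcM !normc_cexp.
  have -> : q1.[p -i* s] = (2 * pi)%:C * (w.1 -i* w.2).
    rewrite /q1 !hornerE; congr (_ * _); rewrite /p /s; congr Complex => /=; ring.
  rewrite !normc_real !normrM !(ger0_norm (expR_ge0 _)).
  have -> : expR (- (pi * w.1 ^+ 2)) = expR (- (pi * z.1 ^+ 2)) *
      expR (re q2.[p -i* s]) * expR (- (pi / 2 * (p ^+ 2 + s ^+ 2))).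
    rewrite -!expRD; congr expR.
    by rewrite /q2 !hornerE /= expr2 /= /p /s; field.
  by ring.
rewrite -mulrBl normrM (ger0_norm (expR_ge0 _)).
move=> Hle; apply: (@le_trans _ _ (normc (H - Q.[p -i* s]) * 1)); last first.
  by rewrite mulr1.
apply: ler_pM => //.
  exact: normc_dist.
by rewrite -(@expR0 R) ler_expR oppr_le0 mulr_ge0 ?divr_ge0 ?pi_ge0 ?addr_ge0 ?sqr_ge0.
Qed.
End Approx.

(** * Lebesgue measure of the plane and radial integrals *)

Section Plane.
Context {R : realType}.
Local Notation mu := (@lebesgue_measure R).
Local Notation R2 := (measurableTypeR R * measurableTypeR R)%type.
Local Notation mu2 := (borel_lebesgue2 R).

Lemma measurable_plane (A : set R2) : measurable A -> measurable (A : set (plane R)).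
Proof. by move=> mA; exact: caratheodory_measurable_mu_ext. Qed.

Lemma measurable_fun_plane : measurable_fun setT (idfun : plane R -> R2).
Proof. by move=> _ Y mY; rewrite setTI; exact: measurable_plane. Qed.

Lemma lebesgue2E (A : set R2) : measurable A -> lebesgue2 R A = mu2 A.
Proof. exact: measurable_mu_extE. Qed.

(** The identity from the plane with its Lebesgue sets to the plane with its
    Borel sets is measurable and pushes the completed measure to the product
    measure. *)
Lemma ge0_integral_lebesgue2 (D : set R2) (h : R2 -> \bar R) :
  measurable D -> measurable_fun D h -> (forall w, D w -> (0 <= h w)%E) ->
  (\int[lebesgue2 R]_(w in D) h w = \int[mu2]_(w in D) h w)%E.
Proof.
move=> mD mh h0.
pose m0 :
  {measure set R2 -> \bar R} := pushforward (lebesgue2 R) (idfun : plane R -> R2).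
pose m := m0 measurable_fun_plane.
have -> : (\int[mu2]_(w in D) h w = \int[m]_(w in D) h w)%E.
  by apply: (@eq_measure_integral _ _ _ D m mu2) => A mA _; rewrite -lebesgue2E.
have h0' : {in D, forall y, (0 <= h y)%E} by move=> w; rewrite inE; exact: h0.
exact: esym (ge0_integral_pushforward measurable_fun_plane (lebesgue2 R) mD mh h0').
Qed.

(** The squared distance is used throughout: it is polynomial, and disks are
    its sublevel sets. *)
Definition sqdist (c w : R2) : R := (w.1 - c.1) ^+ 2 + (w.2 - c.2) ^+ 2.

Lemma sqdist_ge0 c w : 0 <= sqdist c w.
Proof. by rewrite addr_ge0 ?sqr_ge0. Qed.

Lemma measurable_sqdist c : measurable_fun setT (sqdist c).
Proof.
apply: measurable_funD; apply: measurable_funX; apply: measurable_funB => //.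
Qed.

Lemma measurable_sqdist_lt c s : measurable [set w | sqdist c w < s].
Proof.
have := measurable_sqdist c measurableT (measurable_itv `]-oo, s[).
rewrite setTI; congr measurable; apply/seteqP; split => w /=; by rewrite in_itv.
Qed.

Lemma is_derive_continuous (g g' : R -> R) :
  (forall x : R, is_derive x 1 g (g' x)) -> continuous g.
Proof.
move=> dg x; have [d _] := dg x.
exact/differentiable_continuous/derivable1_diffP.
Qed.

Lemma sqr_lt_itv (a s : R) : [set x | (x - a) ^+ 2 < s] =
  `]a - Num.sqrt s, a + Num.sqrt s[%classic.
Proof.
apply/seteqP; split => x /=; rewrite in_itv/= -ltr_distl -sqrtr_sqr.
  by move=> xs; rewrite ltr_sqrt// (le_lt_trans (sqr_ge0 _) xs).
have [s0|s0] := ltP 0 s; first by rewrite ltr_sqrt.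
by rewrite (ler0_sqrtr s0) ltNge sqrtr_ge0.
Qed.

Lemma lebesgue_chord (a s : R) :
  mu [set x | (x - a) ^+ 2 < s] = (2 * Num.sqrt s)%:E.
Proof.
rewrite sqr_lt_itv lebesgue_measure_itv/= lte_fin.
have := sqrtr_ge0 s; rewrite le_eqVlt => /predU1P[<-|s0].
  by rewrite subr0 addr0 ltxx mulr0.
rewrite ifT; last by rewrite ltrD2l gtrN.
by rewrite -EFinB; congr EFin; ring.
Qed.

(** The substitution x = a + q sin(theta) avoids the singularity of the
    derivative at the endpoints. *)
Lemma integral_chord (a q : R) : 0 < q ->
  (\int[mu]_(x in `[(a - q)%R, (a + q)%R]) (2 * Num.sqrt (q ^+ 2 - (x - a) ^+ 2))%:E =
  (pi * q ^+ 2)%:E)%E.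
Proof.
move=> q0.
pose F (th : R) := a + q * sin th.
pose G (x : R) := 2 * Num.sqrt (q ^+ 2 - (x - a) ^+ 2).
have dF (x : R) : is_derive x 1 F (q * cos x).
  have := is_deriveD (is_derive_cst a x 1) (is_deriveZ q (is_derive_sin x)).
  by move/is_derive_eq; apply; rewrite add0r.
have F'E : F^`()%classic = fun x => q * cos x.
  by apply/funext => x; rewrite derive1E; have [_ ->] := dF x.
have ccos : continuous (fun x : R => q * cos x).
  by move=> x; apply: cvgM; [exact: cvg_cst|exact: continuous_cos].
have cF : continuous F := is_derive_continuous dF.
have pi2 : - (pi / 2) < pi / 2 :> R by have := pi_gt0 R; lra.
have Fm : F (- (pi / 2)) = a - q by rewrite /F sinN sin_pihalf; ring.
have Fp : F (pi / 2) = a + q by rewrite /F sin_pihalf; ring.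
rewrite -Fm -Fp.
rewrite (@integration_by_substitution_increasing _ F G) //; last first.
- apply: continuous_subspaceT => x.
  apply: cvgM; first exact: cvg_cst.
  apply: (@continuous_comp _ _ _ (fun x => q ^+ 2 - (x - a) ^+ 2) Num.sqrt).
    apply: cvgB; first exact: cvg_cst.
    apply: (@continuous_comp _ _ _ (fun x => x - a) (fun y => y ^+ 2)).
      by apply: cvgB; [exact: cvg_id|exact: cvg_cst].
    exact: exprn_continuous.
  exact: sqrt_continuous.
- split.
  + by move=> x _; have [] := dF x.
  + by apply: cvg_at_right_filter; exact: cF.
  + by apply: cvg_at_left_filter; exact: cF.
- by rewrite F'E; apply/cvg_ex; eexists; apply: cvg_at_left_filter; exact: ccos.
- by rewrite F'E; apply/cvg_ex; eexists; apply: cvg_at_right_filter; exact: ccos.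
- by move=> x _; rewrite F'E; exact: ccos.
- by move=> x y xI yI xy; rewrite /F ltrD2l ltr_pM2l// ltr_sin.
- exact: ltW.
pose H (x : R) := q ^+ 2 * (x + sin x * cos x).
pose h (x : R) := q ^+ 2 * (2 * cos x ^+ 2).
have dH (x : R) : is_derive x 1 H (h x).
  have := is_deriveZ (q ^+ 2) (is_deriveD (is_derive_id x (1 : R))
    (is_deriveM (is_derive_sin x) (is_derive_cos x))).
  move/is_derive_eq; apply; rewrite /GRing.scale/= /h.
  by have := cos2Dsin2 x; rewrite !expr2 => e; congr (_ * _); lra.
have cH : continuous H := is_derive_continuous dH.
rewrite [LHS](_ : _ = \int[mu]_(x in `[(- (pi / 2))%R, (pi / 2)%R]) (h x)%:E)%E.
  rewrite (@continuous_FTC2 _ h H) //.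
  - by rewrite /H sinN cosN cos_pihalf !mulr0 !addr0 -EFinB; congr EFin; field.
  - apply: continuous_subspaceT => x; apply: cvgM; first exact: cvg_cst.
    apply: cvgM; first exact: cvg_cst.
    apply: (@continuous_comp _ _ _ (@cos R) (fun y => y ^+ 2)).
      exact: continuous_cos.
    exact: exprn_continuous.
  - split.
    + by move=> x _; have [] := dH x.
    + by apply: cvg_at_right_filter; exact: cH.
    + by apply: cvg_at_left_filter; exact: cH.
  - by move=> x _; rewrite derive1E; have [_ ->] := dH x.
apply: eq_integral => x; rewrite inE/= => xI; congr EFin.
have c0 : 0 <= cos x.
  by apply: cos_ge0_pihalf; move: xI; rewrite in_itv.
rewrite [LHS](_ : _ = G (F x) * (q * cos x)); last by rewrite F'E.
rewrite /G /F /h [a + _]addrC addrK.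
have -> : q ^+ 2 - (q * sin x) ^+ 2 = (q * cos x) ^+ 2.
  have := cos2Dsin2 x; rewrite !exprMn; nra.
rewrite sqrtr_sqr ger0_norm; last by rewrite mulr_ge0// ltW.
by ring.
Qed.

Lemma area_disk (c : R2) (s : R) : 0 < s ->
  mu2 [set w | sqdist c w < s] = (pi * s)%:E.
Proof.
move=> s0; rewrite /borel_lebesgue2 /= /product_measure1.
rewrite [LHS](_ : _ = \int[mu]_x (2 * Num.sqrt (s - (x - c.1) ^+ 2))%:E)%E; last first.
  apply: eq_integral => x _ /=; rewrite -(lebesgue_chord c.2); congr (mu _).
  by apply/seteqP; split => y; rewrite /xsection/= inE /= /sqdist/= => ?; lra.
have sq : Num.sqrt s ^+ 2 = s by rewrite sqr_sqrtr// ltW.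
rewrite -{2}sq -(integral_chord c.1); last by rewrite sqrtr_gt0.
rewrite [RHS]integral_mkcond; apply: eq_integral => x _ /=.
rewrite patchE sq; case: ifPn => //; rewrite notin_setE/= in_itv/= => nx.
rewrite ler0_sqrtr ?mulr0// subr_le0 leNgt; apply/negP => xs; apply: nx.
have : [set x | (x - c.1) ^+ 2 < s] x by [].
by rewrite sqr_lt_itv/= in_itv/= => /andP[/ltW -> /ltW ->].
Qed.

Lemma sigma_finite_lebesgue2 : sigma_finite setT (lebesgue2 R).
Proof.
apply: completed_measure_extension_sigma_finite.
exists (fun k => [set w | sqdist (0, 0) w < k.+1%:R]).
  apply/seteqP; split => // w _; exists (Num.bound (sqdist (0, 0) w)) => //=.
  by apply: lt_le_trans (archi_boundP (sqdist_ge0 _ _)) _; rewrite ler_nat.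
move=> k; split; first exact: measurable_sqdist_lt.
by rewrite area_disk// ltry.
Qed.

(** The completed measure bundled with its sigma-finiteness, as the Tonelli
    theorem requires. *)
Definition sigma_lebesgue2 : {sigma_finite_measure set (plane R) -> \bar R} :=
  HB.pack (lebesgue2 R : set (plane R) -> \bar R) (Measure.on (lebesgue2 R))
    (Measure_isSigmaFinite.Build _ _ _ (lebesgue2 R) sigma_finite_lebesgue2).

(** By the area of disks, the image of the plane measure under the squared
    distance and pi times the Lebesgue measure of the half-line agree on the
    intervals ]-oo, x[, hence on all Borel sets. *)
Lemma ge0_integral_radial (c : R2) (s : R) (h : R -> R) :
  measurable_fun setT h -> (forall x, 0 <= h x) ->
  (\int[mu2]_(w in [set w | (sqdist c w < s)%R]) (h (sqdist c w))%:E =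
   pi%:E * \int[mu]_(x in `[0%R, s[) (h x)%:E)%E.
Proof.
move=> mh h0.
have -> : [set w | sqdist c w < s] = sqdist c @^-1` `[0, s[%classic.
  by apply/seteqP; split => w /=; rewrite in_itv/= sqdist_ge0.
pose pin := NngNum (pi_ge0 R).
pose m1 : {measure set (measurableTypeR R) -> \bar R} :=
  mscale pin (mrestr mu (measurable_itv `[(0:R), +oo[)).
have mN : measurable_fun setT (sqdist c : R2 -> measurableTypeR R).
  exact: measurable_sqdist.
pose m0 :
  {measure set (measurableTypeR R) -> \bar R} := pushforward mu2 (sqdist c : R2 -> measurableTypeR R).
pose m2 := m0 mN.
have m2E x : m2 `]-oo, x[%classic = mu2 [set w | sqdist c w < x].
  by congr (mu2 _); apply/seteqP; split => w /=; rewrite in_itv.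
have m1E (X : set (measurableTypeR R)) :
  m1 X = (pi%:E * mu (X `&` `[0%R, +oo[%classic))%E by [].
have m21 A : measurable A -> m2 A = m1 A.
  apply: (@measure_unique _ R (measurableTypeR R) (@RGenInftyO.G R) (fun k => `]-oo, k%:R[%classic) _ _ _ _ m2 m1).
  - exact: RGenInftyO.measurableE.
  - move=> _ _ [x ->] [y ->]; exists (Num.min x y).
    by apply/seteqP; split => z /=; rewrite !in_itv/= lt_min => /andP.
  - by move=> k; exists k%:R.
  - apply/seteqP; split => // x _; exists (Num.bound `|x|) => //=.
    rewrite in_itv/=; apply: le_lt_trans (ler_norm x) _.
    exact: archi_boundP.
  - move=> _ [x ->]; rewrite m2E m1E.
    have [x0|x0] := ltP 0 x.
      rewrite area_disk// (_ : _ `&` _ = `[0, x[%classic); last first.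
        apply/seteqP; split => y /=; rewrite !in_itv/= andbT.
          by move=> [-> ->].
        by move=> /andP[-> ->].
      by rewrite lebesgue_measure_itv/= lte_fin x0 sube0 EFinM.
    rewrite (_ : [set w | _] = set0); last first.
      apply/seteqP; split => w //= wx; have := sqdist_ge0 c w.
      by rewrite leNgt (lt_le_trans wx x0).
    rewrite (_ : _ `&` _ = set0) ?measure0 ?mule0//.
    apply/seteqP; split => y //= []; rewrite !in_itv/= andbT => yx y0.
    by move: (le_lt_trans y0 yx); rewrite ltNge x0.
  - move=> k; rewrite m2E.
    apply: (@le_lt_trans _ _ (mu2 [set w | sqdist c w < k.+1%:R])).
      apply: le_measure; rewrite ?inE; try exact: measurable_sqdist_lt.
      by move=> w /= /lt_le_trans; apply; rewrite ler_nat.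
    by rewrite area_disk// ltry.
have mD : measurable (`[0, s[%classic : set (measurableTypeR R)) by exact: measurable_itv.
have mh' : measurable_fun (`[0, s[%classic : set (measurableTypeR R)) (EFin \o h).
  by apply/measurable_EFinP; exact: measurable_funTS.
have h0' : {in `[0, s[%classic, forall y, (0 <= (EFin \o h) y)%E}.
  by move=> y _; rewrite lee_fin.
pose m3 : {measure set (measurableTypeR R) -> \bar R} := mscale pin mu.
transitivity (\int[m2]_(x in `[0%R, s[) (h x)%:E)%E.
  exact: esym (ge0_integral_pushforward mN mu2 mD mh' h0').
transitivity (\int[m3]_(x in `[0%R, s[) (h x)%:E)%E; last first.
  rewrite (@ge0_integral_mscale _ (measurableTypeR R) R mu _ mD pin (EFin \o h))//.
  by move=> y _; rewrite lee_fin.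
apply: eq_measure_integral => A mA As; rewrite m21// m1E.
rewrite (_ : m3 A = pi%:E * mu A)%E//; congr (_ * mu _)%E.
by apply/setIidPl => y /As /=; rewrite !in_itv/= andbT => /andP[].
Qed.

Lemma integral_gauss_disk (c : R2) (al s : R) : 0 < al -> 0 < s ->
  (\int[mu2]_(w in [set w | (sqdist c w < s)%R]) (expR (- (al * sqdist c w)))%:E =
   (pi / al * (1 - expR (- (al * s))))%:E)%E.
Proof.
move=> al0 s0.
have df (x : R) : is_derive x 1 (fun y : R => - (al * y)) (- al).
  have := is_deriveN (is_deriveZ al (is_derive_id x (1 : R))).
  by move/is_derive_eq; apply; rewrite /GRing.scale/= mulr1.
have de (x : R) : is_derive x 1 (fun y => expR (- (al * y))) (expR (- (al * x)) * - al).
  exact: is_derive1_comp.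
have ce : continuous (fun y : R => expR (- (al * y))) := is_derive_continuous de.
rewrite (@ge0_integral_radial c s (fun y => expR (- (al * y)))); last 2 first.
- exact: continuous_measurable_fun.
- by move=> x; exact: expR_ge0.
rewrite integral_itv_bndo_bndc; last first.
  by apply/measurable_EFinP; apply: measurable_funTS; exact: continuous_measurable_fun.
pose F (x : R) := - al^-1 * expR (- (al * x)).
have dF (x : R) : is_derive x 1 F (expR (- (al * x))).
  have := is_deriveZ (- al^-1) (de x).
  move/is_derive_eq; apply; rewrite /GRing.scale/=; field; lra.
have cF : continuous F := is_derive_continuous dF.
rewrite (@continuous_FTC2 _ (fun y => expR (- (al * y))) F) //.
- by rewrite -EFinB -EFinM /F mulr0 oppr0 expR0; congr EFin; field; lra.
- exact: continuous_subspaceT.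
- split.
  + by move=> x _; have [] := dF x.
  + by apply: cvg_at_right_filter; exact: cF.
  + by apply: cvg_at_left_filter; exact: cF.
- by move=> x _; rewrite derive1E; have [_ ->] := dF x.
Qed.

End Plane.

(** * A sub-mean value inequality for polynomials *)

Section Green.
Local Open Scope complex_scope.
Context {R : realType}.
Local Notation C := (complex R).
Local Notation re := (@complex.Re R).
Local Notation im := (@complex.Im R).
Local Notation normc := (@Normc.normc R).
Local Notation mu := (@lebesgue_measure R).
Local Notation R2 := (measurableTypeR R * measurableTypeR R)%type.
Local Notation mu2 := (borel_lebesgue2 R).
Implicit Types (c w : R2) (s : R) (Q : {poly C}).

(** The set is an open interval whose endpoints satisfy (x - a)^2 = s; it is
    empty if s <= 0. *)
Lemma green_slice (a s : R) (g g' : R -> R) :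
  (forall x : R, is_derive x 1 g (g' x)) -> continuous g' ->
  (forall x, (x - a) ^+ 2 = s -> g x = 0) ->
  (\int[mu]_(x in [set x | ((x - a) ^+ 2 < s)%R]) (g' x)%:E = 0)%E.
Proof.
move=> dg cg' g0; rewrite sqr_lt_itv.
have [s0|s0] := ltP 0 s; last first.
  by rewrite ler0_sqrtr// subr0 addr0 set_itv_ge ?integral_set0// bnd_simp ltxx.
have q0 : 0 < Num.sqrt s by rewrite sqrtr_gt0.
have gE (q : R) : q ^+ 2 = s -> g (a + q) = 0.
  by move=> qs; apply: g0; rewrite addrAC subrr add0r.
have cg := is_derive_continuous dg.
rewrite -(@integral_itv_bndoo _ _ _ _ true false); last first.
  apply/measurable_EFinP; apply: measurable_funTS.
  exact: continuous_measurable_fun.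
rewrite (@continuous_FTC2 _ g' g).
- rewrite !gE ?subee// ?sqrrN ?sqr_sqrtr//; exact: ltW.
- by rewrite ltrD2l gtrN.
- exact: continuous_subspaceT.
- split.
  + by move=> x _; have [] := dg x.
  + by apply: cvg_at_right_filter; exact: cg.
  + by apply: cvg_at_left_filter; exact: cg.
- by move=> x _; rewrite derive1E; have [_ ->] := dg x.
Qed.

Definition sqdisk c s : set R2 := [set w | sqdist c w < s].

(** Measurable, and bounded on the disk: a class of functions stable under
    sums and products, all of whose members are integrable on the disk. *)
Definition tame c s (h : R2 -> R) := measurable_fun setT h /\
  exists2 M : R, 0 <= M & forall w, sqdisk c s w -> `|h w| <= M.

Lemma tame_cst c s (a : R) : tame c s (fun=> a).
Proof. by split=> //; exists `|a|. Qed.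

Lemma tameD c s g h : tame c s g -> tame c s h -> tame c s (fun w => g w + h w).
Proof.
move=> [mg [M M0 gM]] [mh [N N0 hN]]; split; first exact: measurable_funD.
exists (M + N) => [|w wD]; first exact: addr_ge0.
by apply: le_trans (ler_normD _ _) _; apply: lerD; [exact: gM|exact: hN].
Qed.

Lemma tameM c s g h : tame c s g -> tame c s h -> tame c s (fun w => g w * h w).
Proof.
move=> [mg [M M0 gM]] [mh [N N0 hN]]; split; first exact: measurable_funM.
exists (M * N) => [|w wD]; first exact: mulr_ge0.
by rewrite normrM; apply: ler_pM => //; [exact: gM|exact: hN].
Qed.

Lemma tame_integrable c s h : 0 < s -> tame c s h ->
  mu2.-integrable (sqdisk c s) (EFin \o h).
Proof.
move=> s0 [mh [M M0 hM]]; apply: measurable_bounded_integrable.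
- exact: measurable_sqdist_lt.
- by rewrite area_disk// ltry.
- exact: measurable_funTS.
- exists M; split; first exact: num_real.
  by move=> x Mx w wD; apply: le_trans (hM w wD) _; exact: ltW.
Qed.

(** Fubini reduces this to one integral per horizontal chord, where the
    fundamental theorem of calculus gives the difference of two zero boundary
    values. *)
Lemma green_x c s (g g' : R2 -> R) : 0 < s -> tame c s g' ->
  (forall x y : R, is_derive x 1 (fun x => g (x, y)) (g' (x, y))) ->
  (forall y, continuous (fun x : R => g' (x, y))) ->
  (forall w, sqdist c w = s -> g w = 0) ->
  (\int[mu2]_(w in sqdisk c s) (g' w)%:E = 0)%E.
Proof.
move=> s0 tg' dg cg' g0.
have mD : measurable (sqdisk c s) by exact: measurable_sqdist_lt.
have ig := tame_integrable s0 tg'.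
rewrite integral_mkcond.
have := (integrable_mkcond (EFin \o g') mD).1 ig => {}ig.
transitivity (\int[mu]_y (0 : \bar R))%E; last exact: integral0.
rewrite -[LHS](integral21_prod_meas1 ig).
apply: eq_integral => y _.
transitivity (\int[mu]_(x in [set x | ((x - c.1) ^+ 2 < s - (y - c.2) ^+ 2)%R])
   (g' (x, y))%:E)%E; last first.
  apply: (green_slice (dg ^~ y)) => // x xs.
  by apply: g0; rewrite /sqdist/= xs subrK.
rewrite [RHS]integral_mkcond; apply: eq_integral => x _.
rewrite /= !patchE; congr (if _ then _ else _).
by apply/idP/idP; rewrite !inE /sqdisk/= /sqdist/= ltrBrDr.
Qed.

Lemma green_y c s (g g' : R2 -> R) : 0 < s -> tame c s g' ->
  (forall x y : R, is_derive y 1 (fun y => g (x, y)) (g' (x, y))) ->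
  (forall x, continuous (fun y : R => g' (x, y))) ->
  (forall w, sqdist c w = s -> g w = 0) ->
  (\int[mu2]_(w in sqdisk c s) (g' w)%:E = 0)%E.
Proof.
move=> s0 tg' dg cg' g0.
have mD : measurable (sqdisk c s) by exact: measurable_sqdist_lt.
have ig := tame_integrable s0 tg'.
rewrite integral_mkcond.
have := (integrable_mkcond (EFin \o g') mD).1 ig => {}ig.
transitivity (\int[mu]_x (0 : \bar R))%E; last exact: integral0.
rewrite -[LHS](integral12_prod_meas1 ig).
apply: eq_integral => x _.
transitivity (\int[mu]_(y in [set y | ((y - c.2) ^+ 2 < s - (x - c.1) ^+ 2)%R])
   (g' (x, y))%:E)%E; last first.
  apply: (green_slice (dg x)) => // y ys.
  by apply: g0; rewrite /sqdist/= ys addrC subrK.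
rewrite [RHS]integral_mkcond; apply: eq_integral => y _.
rewrite /= !patchE; congr (if _ then _ else _).
by apply/idP/idP; rewrite !inE /sqdisk/= /sqdist/= ltrBrDl.
Qed.

(** The complex coordinate relative to c; the conjugation matches the sign of
    the frequency in the transform. *)
Definition zdiff c w : C := (w.1 - c.1) -i* (w.2 - c.2).

Lemma normc_zdiff c w : normc (zdiff c w) ^+ 2 = sqdist c w.
Proof. by rewrite /= sqr_sqrtr ?sqrrN// addr_ge0 ?sqr_ge0. Qed.

Lemma normc_zdiff_le c s w : sqdisk c s w -> normc (zdiff c w) <= Num.sqrt s.
Proof.
move=> ws; rewrite -[leLHS]ger0_norm ?normc_ge0// -sqrtr_sqr normc_zdiff.
by rewrite ler_wsqrtr// ltW.
Qed.

Lemma measurable_horner c Q :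
  measurable_fun setT (fun w : R2 => re Q.[zdiff c w]) /\
  measurable_fun setT (fun w : R2 => im Q.[zdiff c w]).
Proof.
have m1 : measurable_fun setT (fun w : R2 => w.1 - c.1).
  exact: measurable_funB.
have m2 : measurable_fun setT (fun w : R2 => - (w.2 - c.2)).
  by apply: measurable_funN; exact: measurable_funB.
elim/poly_ind: Q => [|Q a [mr mi]].
  by split; under eq_fun do rewrite horner0; exact: measurable_cst.
split; under eq_fun do rewrite hornerMXaddC.
  under eq_fun do rewrite reD reM /=.
  by apply: measurable_funD => //; apply: measurable_funB; exact: measurable_funM.
under eq_fun do rewrite imD imM /=.
by apply: measurable_funD => //; apply: measurable_funD; exact: measurable_funM.
Qed.

Lemma tame_re c s Q : tame c s (fun w => re Q.[zdiff c w]).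
Proof.
split; first exact: (measurable_horner c Q).1.
have [B B0 HB] := poly_bounded (Num.sqrt s) Q; exists B => // w /normc_zdiff_le ws.
exact: le_trans (normr_re _) (HB _ ws).
Qed.

Lemma tame_im c s Q : tame c s (fun w => im Q.[zdiff c w]).
Proof.
split; first exact: (measurable_horner c Q).2.
have [B B0 HB] := poly_bounded (Num.sqrt s) Q; exists B => // w /normc_zdiff_le ws.
exact: le_trans (normr_im _) (HB _ ws).
Qed.

Lemma measurable_sqrt : measurable_fun setT (@Num.sqrt R).
Proof. by apply: continuous_measurable_fun; exact: sqrt_continuous. Qed.

Lemma measurable_normc_horner c Q :
  measurable_fun setT (fun w : R2 => normc Q.[zdiff c w]).
Proof.
have -> : (fun w : R2 => normc Q.[zdiff c w]) =
    (fun w => Num.sqrt (re Q.[zdiff c w] ^+ 2 + im Q.[zdiff c w] ^+ 2)).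
  by apply/funext => w; case: Q.[zdiff c w].
have [mr mi] := measurable_horner c Q.
apply: (measurableT_comp measurable_sqrt).
by apply: measurable_funD; exact: measurable_funX.
Qed.

Lemma tame_normc c s Q : tame c s (fun w => normc Q.[zdiff c w]).
Proof.
split; first exact: measurable_normc_horner.
have [B B0 HB] := poly_bounded (Num.sqrt s) Q; exists B => // w /normc_zdiff_le ws.
by rewrite ger0_norm ?normc_ge0//; exact: HB.
Qed.

Lemma measurable_gauss2 c (al : R) :
  measurable_fun setT (fun w : R2 => expR (- (al * sqdist c w))).
Proof.
apply: measurableT_comp; first exact: measurable_expR.
apply: measurable_funN; apply: measurable_funM => //.
exact: measurable_sqdist.
Qed.

Lemma tame_gauss c s (al : R) : 0 <= al ->
  tame c s (fun w => expR (- (al * sqdist c w))).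
Proof.
move=> al0; split; first exact: measurable_gauss2.
exists 1 => // w _; rewrite ger0_norm ?expR_ge0// -(@expR0 R) ler_expR oppr_le0.
by rewrite mulr_ge0 ?sqdist_ge0.
Qed.

Lemma cderiv_horner (phi phi' : R -> C) Q : cderiv phi phi' ->
  cderiv (fun t => Q.[phi t]) (fun t => phi' t * Q^`().[phi t]).
Proof.
move=> d; elim/poly_ind: Q => [|Q a IH].
  rewrite (_ : (fun _ => _) = fun=> 0); last first.
    by apply/funext => t; rewrite horner0.
  by apply: cderiv_eq (cderiv_cst 0) _ => t; rewrite deriv0 horner0 mulr0.
rewrite (_ : (fun _ => _) = fun t => Q.[phi t] * phi t + a); last first.
  by apply/funext => t; rewrite hornerMXaddC.
apply: cderiv_eq (cderivD (cderivM IH d) (cderiv_cst a)) _ => t.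
by rewrite derivMXaddC !hornerE; ring.
Qed.

Lemma cderiv_zdiff1 c (y : R) : cderiv (fun x => zdiff c (x, y)) (fun=> 1).
Proof.
move=> t; split; last exact: (is_derive_cst (- (y - c.2)) t (1 : R)).
have := is_deriveB (is_derive_id t (1:R)) (is_derive_cst c.1 t 1).
by rewrite subr0.
Qed.

(** The derivative -i, together with 1 in the other variable, encodes the
    Cauchy-Riemann equations. *)
Lemma cderiv_zdiff2 c (x : R) : cderiv (fun y => zdiff c (x, y)) (fun=> 0 -i* 1).
Proof.
move=> t; split; first exact: (is_derive_cst (x - c.1) t (1 : R)).
have := is_deriveN (is_deriveB (is_derive_id t (1:R)) (is_derive_cst c.2 t 1)).
by rewrite subr0.
Qed.

Lemma is_derive_gauss (a q t : R) :
  is_derive t 1 (fun x => expR (- (pi * ((x - a) ^+ 2 + q))))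
    (- (2 * pi * (t - a)) * expR (- (pi * ((t - a) ^+ 2 + q)))).
Proof.
have d1 : is_derive t 1 (fun x : R => x - a) 1.
  by have := is_deriveB (is_derive_id t (1 : R)) (is_derive_cst a t 1); rewrite subr0.
have d2 : is_derive t 1 (fun x => - (pi * ((x - a) ^+ 2 + q))) (- (2 * pi * (t - a))).
  have -> : (fun x => - (pi * ((x - a) ^+ 2 + q))) =
            (fun x => - (pi * ((x - a) * (x - a) + q))).
    by apply/funext => x; rewrite expr2.
  have := is_deriveN (is_deriveZ pi (is_deriveD (is_deriveM d1 d1) (is_derive_cst q t 1))).
  by move/is_derive_eq; apply; rewrite /GRing.scale/=; ring.
rewrite mulrC; exact: is_derive1_comp.
Qed.

(** With u = Q(v) (exp(-pi |v|^2) - exp(-pi s)), which vanishes on the circle,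
    the Cauchy-Riemann equations for Q give d/dx Re u + d/dy Im u = -2 pi Re(v
    Q(v)) exp(-pi |v|^2), and both terms on the left have integral 0. *)
Lemma green_horner c s Q : 0 < s ->
  (\int[mu2]_(w in sqdisk c s)
    (re (Q.[zdiff c w] * zdiff c w) * expR (- (pi * sqdist c w)))%:E = 0)%E.
Proof.
move=> s0.
pose e w := expR (- (pi * sqdist c w)).
pose k w := e w - expR (- (pi * s)).
pose g1 w := re Q.[zdiff c w] * k w.
pose g2 w := im Q.[zdiff c w] * k w.
pose g1' w := re Q^`().[zdiff c w] * k w + re Q.[zdiff c w] * (- (2 * pi) * re ('X).[zdiff c w] * e w).
pose g2' w := - re Q^`().[zdiff c w] * k w - im Q.[zdiff c w] * (- (2 * pi) * im ('X).[zdiff c w] * e w).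
have te : tame c s e by apply: tame_gauss; exact: pi_ge0.
have tk : tame c s k by apply: tameD te (tame_cst _ _ _).
have tg1 : tame c s g1'.
  apply: tameD; first exact: tameM (tame_re _ _ _) tk.
  apply: tameM (tame_re _ _ _) _; apply: tameM te.
  exact: tameM (tame_cst _ _ _) (tame_re _ _ _).
have tg2 : tame c s g2'.
  rewrite (_ : g2' = fun w => (-1) * (re Q^`().[zdiff c w] * k w) +
      (-1) * (im Q.[zdiff c w] * (- (2 * pi) * im ('X).[zdiff c w] * e w))); last first.
    by apply/funext => w; rewrite /g2'; ring.
  apply: tameD; apply: tameM (tame_cst _ _ _) _; first exact: tameM (tame_re _ _ _) tk.
  apply: tameM (tame_im _ _ _) _; apply: tameM te.
  exact: tameM (tame_cst _ _ _) (tame_im _ _ _).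
have dex (x y : R) : is_derive x 1 (fun x => e (x, y)) (- (2 * pi) * re ('X).[zdiff c (x, y)] * e (x, y)).
  have := is_derive_gauss c.1 ((y - c.2) ^+ 2) x.
  by move/is_derive_eq; apply; rewrite hornerX /= /e /sqdist/=; ring.
have dey (x y : R) : is_derive y 1 (fun y => e (x, y)) (2 * pi * im ('X).[zdiff c (x, y)] * e (x, y)).
  have eE z : e (x, z) = expR (- (pi * ((z - c.2) ^+ 2 + (x - c.1) ^+ 2))).
    by rewrite /e /sqdist/= addrC.
  under eq_fun do rewrite eE.
  have := is_derive_gauss c.2 ((x - c.1) ^+ 2) y.
  by move/is_derive_eq; apply; rewrite hornerX /= eE; ring.
have dkx (x y : R) : is_derive x 1 (fun x => k (x, y)) (- (2 * pi) * re ('X).[zdiff c (x, y)] * e (x, y)).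
  have := is_deriveB (dex x y) (is_derive_cst (expR (- (pi * s))) x 1).
  by rewrite subr0.
have dky (x y : R) : is_derive y 1 (fun y => k (x, y)) (2 * pi * im ('X).[zdiff c (x, y)] * e (x, y)).
  have := is_deriveB (dey x y) (is_derive_cst (expR (- (pi * s))) y 1).
  by rewrite subr0.
have dQx P y x := cderiv_horner P (cderiv_zdiff1 c y) x.
have dQy P x y := cderiv_horner P (cderiv_zdiff2 c x) y.
have cre P y : continuous (fun x : R => re P.[zdiff c (x, y)]).
  by apply: is_derive_continuous => x; have [] := dQx P y x.
have cre' P x : continuous (fun y : R => re P.[zdiff c (x, y)]).
  by apply: is_derive_continuous => y; have [] := dQy P x y.
have cim' P x : continuous (fun y : R => im P.[zdiff c (x, y)]).
  by apply: is_derive_continuous => y; have [] := dQy P x y.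
have I1 : (\int[mu2]_(w in sqdisk c s) (g1' w)%:E = 0)%E.
  apply: (@green_x c s g1) => //.
  - move=> x y; have [d _] := dQx Q y x.
    have := is_deriveM d (dkx x y).
    by move/is_derive_eq; apply; rewrite mul1r /GRing.scale/= /g1'; ring.
  - move=> y x; apply: cvgD; apply: cvgM.
    + exact: cre.
    + exact: (is_derive_continuous (dkx ^~ y)).
    + exact: cre.
    + apply: cvgM; last exact: (is_derive_continuous (dex ^~ y)).
      by apply: cvgM; [exact: cvg_cst|exact: cre].
  - by move=> w ws; rewrite /g1 /k /e ws subrr mulr0.
have I2 : (\int[mu2]_(w in sqdisk c s) (g2' w)%:E = 0)%E.
  apply: (@green_y c s g2) => //.
  - move=> x y; have [_ d] := dQy Q x y.
    have := is_deriveM d (dky x y).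
    by move/is_derive_eq; apply; rewrite imM /= /GRing.scale/= /g2'; ring.
  - move=> x y; apply: cvgB; apply: cvgM.
    + by apply: cvgN; exact: cre'.
    + exact: (is_derive_continuous (dky x)).
    + exact: cim'.
    + apply: cvgM; last exact: (is_derive_continuous (dey x)).
      by apply: cvgM; [exact: cvg_cst|exact: cim'].
  - by move=> w ws; rewrite /g2 /k /e ws subrr mulr0.
have mD : measurable (sqdisk c s) by exact: measurable_sqdist_lt.
pose h w := re (Q.[zdiff c w] * zdiff c w) * e w.
have th : tame c s h.
  rewrite (_ : h = fun w => re (Q * 'X).[zdiff c w] * e w); last first.
    by apply/funext => w; rewrite hornerMX.
  exact: tameM (tame_re _ _ _) te.
have : (\int[mu2]_(w in sqdisk c s) ((EFin \o g1') w + (EFin \o g2') w) = 0)%E.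
  rewrite integralD//; [|exact: tame_integrable..].
  by rewrite [X in (X + _)%E]I1 [X in (_ + X)%E]I2 adde0.
rewrite (_ : (fun w => _) = (fun w => (- (2 * pi))%:E * (EFin \o h) w)%E); last first.
  apply/funext => w; rewrite /= -EFinD -EFinM; congr EFin.
  by rewrite /g1' /g2' /h reM hornerX; ring.
rewrite integralZl//; last exact: tame_integrable.
move/eqP; rewrite mule_eq0 eqe oppr_eq0 mulf_eq0 pnatr_eq0/= gt_eqF ?pi_gt0//=.
by move/eqP.
Qed.

(** Split off the constant term a, whose contribution is explicit, while the
    rest integrates to 0 by Green's formula. A unimodular factor makes a real
    nonnegative, so that real parts suffice. *)
Lemma submean_horner c s Q : 0 < s ->
  ((normc Q.[0] * (1 - expR (- (pi * s))))%:E <=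
  \int[mu2]_(w in sqdisk c s)
    (normc Q.[zdiff c w] * expR (- (pi * sqdist c w)))%:E)%E.
Proof.
move=> s0; elim/poly_ind: Q => [|Q a _]; last rewrite hornerMXaddC mulr0 add0r.
  rewrite horner0 Normc.normc0 mul0r; apply: integral_ge0 => w _.
  by rewrite lee_fin mulr_ge0 ?normc_ge0 ?expR_ge0.
have [th th1 tha] : exists2 th : C, normc th = 1 & th * a = (normc a)%:C.
  have [->|a0] := eqVneq a 0.
    by exists 1; rewrite ?Normc.normc1 ?mulr0 ?Normc.normc0.
  exists ((normc a)%:C / a); last by rewrite divfK.
  rewrite Normc.normcM normc_real Normc.normcV ger0_norm ?normc_ge0// divff//.
  by apply: contra a0 => /eqP/Normc.eq0_normc ->.
pose e w := expR (- (pi * sqdist c w)).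
pose h w := re ((th *: Q).[zdiff c w] * zdiff c w) * e w.
have te : tame c s e by apply: tame_gauss; exact: pi_ge0.
have th' : tame c s h.
  rewrite (_ : h = fun w => re (th *: Q * 'X).[zdiff c w] * e w); last first.
    by apply/funext => w; rewrite hornerMX.
  exact: tameM (tame_re _ _ _) te.
have ta : tame c s (fun w => normc a * e w) by exact: tameM (tame_cst _ _ _) te.
have mD : measurable (sqdisk c s) by exact: measurable_sqdist_lt.
have -> : (normc a * (1 - expR (- (pi * s))))%:E =
    (\int[mu2]_(w in sqdisk c s) ((EFin \o h) w + (EFin \o (fun w => normc a * e w)%R) w))%E.
  rewrite integralD//; [|exact: tame_integrable..].
  rewrite [X in (X + _)%E]green_horner// add0e.
  under eq_integral do rewrite /= EFinM.
  rewrite integralZl//; last exact: tame_integrable.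
  rewrite [X in (_ * X)%E](@integral_gauss_disk _ c pi s)// ?pi_gt0//.
  by rewrite divff ?mul1r// gt_eqF ?pi_gt0.
apply: le_integral => //.
- by apply: integrableD => //; exact: tame_integrable.
- exact: tame_integrable (tameM (tame_normc _ _ _) te).
move=> w _; rewrite /= -EFinD lee_fin /h -mulrDl ler_wpM2r ?expR_ge0//.
rewrite hornerMXaddC -[leRHS]mul1r -th1 -Normc.normcM.
apply: le_trans (le_trans (ler_norm _) (normr_re _)).
by rewrite mulrDr tha reD hornerZ mulrA.
Qed.

End Green.

(** * The local inequality and the bathtub bound *)

Section Final.
Local Open Scope complex_scope.
Context {R : realType}.
Local Notation C := (complex R).
Local Notation re := (@complex.Re R).
Local Notation im := (@complex.Im R).
Local Notation normc := (@Normc.normc R).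
Local Notation R2 := (measurableTypeR R * measurableTypeR R)%type.
Local Notation mu2 := (borel_lebesgue2 R).
Local Notation leb2 := (lebesgue2 R).

Lemma measurable_fun_from_borel d (T : measurableType d) (h : R2 -> T) :
  measurable_fun setT h -> measurable_fun setT (h : plane R -> T).
Proof. by move=> mh; exact: measurableT_comp mh measurable_fun_plane. Qed.

Lemma measurable_disk (r : R) (z : plane R) : measurable (disk r z).
Proof. by apply: measurable_plane; exact: measurable_sqdist_lt. Qed.

Lemma lebesgue2_disk (r : R) (z : plane R) : 0 < r ->
  leb2 (disk r z) = (pi * r ^+ 2)%:E.
Proof.
move=> r0; rewrite [LHS]lebesgue2E; last exact: measurable_sqdist_lt.
by rewrite [LHS]area_disk// exprn_gt0.
Qed.

(** The inequality for an approximating polynomial Q holds with an error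
    proportional to the quality e of the approximation, at z and, integrated,
    on the disk; e is chosen so that the total error is d. *)
Lemma stft_submean (f : (R -> C) -> C) (z : plane R) (r : R) :
  tempered f -> 0 < r ->
  measurable_fun setT (fun w : plane R => normc (stft (@h0 R) f w)) ->
  (((1 - expR (- (pi * r ^+ 2))) * normc (stft (@h0 R) f z))%:E <=
  \int[leb2]_(w in disk r z)
    (normc (stft (@h0 R) f w) * expR (- (pi / 2 * sqdist z w)))%:E)%E.
Proof.
move=> tf r0; pose V w := normc (stft (@h0 R) f w) => mV.
pose g w := expR (- (pi / 2 * sqdist z w)).
have mg : measurable_fun setT (g : plane R -> R).
  by apply: measurable_fun_from_borel; exact: measurable_gauss2.
have g0 w : 0 <= g w by exact: expR_ge0.
have g1 w : g w <= 1.
  rewrite -(@expR0 R) ler_expR oppr_le0 mulr_ge0 ?sqdist_ge0//.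
  by rewrite divr_ge0 ?pi_ge0.
have E1 : 0 <= 1 - expR (- (pi * r ^+ 2)) <= 1.
  have := expR_ge0 (- (pi * r ^+ 2)).
  have : expR (- (pi * r ^+ 2)) <= 1.
    by rewrite -(@expR0 R) ler_expR oppr_le0 mulr_ge0 ?pi_ge0 ?sqr_ge0.
  by move=> *; apply/andP; split; lra.
apply/lee_addgt0Pr => d d0.
(* An error e at z and an error e on the disk, of area pi r^2. *)
pose e := d / (1 + pi * r ^+ 2).
have den0 : 0 < 1 + pi * r ^+ 2.
  by rewrite ltr_wpDr// mulr_ge0 ?pi_ge0 ?sqr_ge0.
have e0 : 0 < e by rewrite divr_gt0.
have [Q HQ] := stft_approx z tf r0 e0.
have zz : V z <= normc Q.[0] + e.
  have zz0 : (z.1 - z.1) -i* (z.2 - z.2) = 0 :> C by rewrite !subrr oppr0.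
  have := HQ z; rewrite zz0 /disk/= !subrr expr0n/= addr0 mulr0 oppr0 expR0 mulr1.
  rewrite -/(V z) => /(_ (exprn_gt0 2 r0)).
  by move=> /ler_normlP[_]; lra.
have mD := measurable_disk r z.
have mh : measurable_fun setT (fun w : R2 => (normc Q.[zdiff z w] * expR (- (pi * sqdist z w)))%:E).
  apply/measurable_EFinP; apply: measurable_funM; last exact: measurable_gauss2.
  exact: measurable_normc_horner.
have h0' w : (0 <= (normc Q.[zdiff z w] * expR (- (pi * sqdist z w)))%:E)%E.
  by rewrite lee_fin mulr_ge0 ?normc_ge0 ?expR_ge0.
apply: (@le_trans _ _ (((normc Q.[0] * (1 - expR (- (pi * r ^+ 2))))%:E + e%:E)%E)).
  rewrite -EFinD lee_fin -/(V z); case/andP: E1; nra.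
have sub := @submean_horner R z (r ^+ 2) Q (exprn_gt0 2 r0).
move: sub; rewrite -(@ge0_integral_lebesgue2 R); last 3 first.
- exact: measurable_sqdist_lt.
- exact: measurable_funTS.
- by move=> w _; exact: h0'.
move=> sub; apply: le_trans (leeD2r _ sub) _.
have mVg : measurable_fun (disk r z) (fun w => (V w * g w)%:E).
  by apply: measurable_funTS; apply/measurable_EFinP; exact: measurable_funM.
have mVge : measurable_fun (disk r z) (fun w => (V w * g w)%:E + e%:E)%E.
  by apply: emeasurable_funD => //; exact: measurable_cst.
have Vg0 w : disk r z w -> (0 <= (V w * g w)%:E)%E.
  by move=> _; rewrite lee_fin mulr_ge0 ?normc_ge0.
have e_ge0 : (0 <= e%:E)%E by rewrite lee_fin ltW.
apply: (@le_trans _ _ (\int[leb2]_(w in disk r z) ((V w * g w)%:E + e%:E) + e%:E)%E).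
  apply: leeD2r; apply: ge0_le_integral.
  - exact: mD.
  - by move=> w _; exact: h0'.
  - by apply: measurable_funTS; exact: (measurable_fun_from_borel mh).
  - exact: mVge.
  - move=> w wD; have := HQ w wD; rewrite -/(V w) -EFinD lee_fin.
    rewrite (_ : expR (- (pi * sqdist z w)) = g w * g w); last first.
      by rewrite -expRD; congr expR; field.
    rewrite -/(zdiff z w) -/(sqdist z w) -/(g w) => /ler_normlP[+ _].
    by have := g0 w; have := g1 w; rewrite mulrA; nra.
rewrite (ge0_integralD leb2 mD Vg0 mVg (fun _ _ => e_ge0) (measurable_cst _)).
rewrite -addeA; apply: leeD2l; rewrite (integral_cst leb2 mD).
rewrite lebesgue2_disk// -EFinM -EFinD lee_fin.
have -> : e * (pi * r ^+ 2) + e = e * (1 + pi * r ^+ 2) by ring.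
by rewrite /e divfK// gt_eqF.
Qed.

(** For every threshold t, the Gaussian is at most t plus its excess over t,
    so its integral on A is at most t m plus the integral of the excess on the
    whole plane. The choice t = exp(-m/2) makes the excess live on the disk of
    area m, and equality holds for that disk. *)
Lemma bathtub (c : plane R) (A : set (plane R)) (m : R) :
  measurable A -> (leb2 A <= m%:E)%E ->
  (\int[leb2]_(w in A) (expR (- (pi / 2 * sqdist c w)))%:E <=
   (2 * (1 - expR (- (m / 2))))%:E)%E.
Proof.
move=> mA Am.
have m0 : 0 <= m by rewrite -lee_fin (le_trans _ Am).
pose g w := expR (- (pi / 2 * sqdist c w)).
pose t := expR (- (m / 2)).
(* the excess of g over t *)
pose h w := Num.max (g w - t) 0.
have t0 : 0 <= t by exact: expR_ge0.
have mg : measurable_fun setT (g : plane R -> R).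
  by apply: measurable_fun_from_borel; exact: measurable_gauss2.
have mh : measurable_fun setT (h : plane R -> R).
  exact: measurable_maxr (measurable_funB mg (measurable_cst _)) (measurable_cst _).
have h0 w : 0 <= h w by rewrite le_max lexx orbT.
have t0' : (0 <= t%:E)%E by rewrite lee_fin.
have h0' w : (0 <= (h w)%:E)%E by rewrite lee_fin.
have mh' : measurable_fun setT (fun w : plane R => (h w)%:E) by exact/measurable_EFinP.
have gh w : g w <= t + h w.
  by have : g w - t <= h w; [rewrite le_max lexx|lra].
have int_h : ((m * t)%:E + \int[leb2]_w (h w)%:E <= (2 * (1 - t))%:E)%E.
  pose D : set (plane R) := [set w | sqdist c w < m / pi].
  have mD : measurable D by apply: measurable_plane; exact: measurable_sqdist_lt.
  have -> : (\int[leb2]_w (h w)%:E = \int[leb2]_(w in D) (h w)%:E)%E.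
    rewrite [RHS]integral_mkcond; apply: eq_integral => w _.
    rewrite patchE; case: ifPn => //; rewrite notin_setE/= => /negP.
    rewrite -leNgt => wD; congr EFin; rewrite /h; apply: max_r.
    rewrite subr_le0 ler_expR lerN2.
    by move: wD; rewrite ler_pdivrMr ?pi_gt0//; lra.
  (* The area formula is for disks of positive radius. *)
  have [m_eq0|mn0] := eqVneq m 0.
    have -> : D = set0.
      apply/seteqP; split => w //; rewrite /D/= m_eq0 mul0r.
      by rewrite ltNge sqdist_ge0.
    by rewrite integral_set0 adde0 /t m_eq0 !mul0r oppr0 expR0 subrr mulr0.
  have m_gt0 : 0 < m by rewrite lt_neqAle eq_sym mn0.
  have s0 : 0 < m / pi by rewrite divr_gt0 ?pi_gt0.
  have areaD : leb2 D = m%:E.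
    rewrite [LHS]lebesgue2E; last exact: measurable_sqdist_lt.
    rewrite [LHS]area_disk//; congr EFin.
    by rewrite mulrCA divff ?mulr1// gt_eqF ?pi_gt0.
  have -> : ((m * t)%:E = \int[leb2]_(w in D) t%:E)%E.
    by rewrite (integral_cst leb2 mD) areaD -EFinM mulrC.
  rewrite -(ge0_integralD leb2 mD (fun _ _ => t0') (measurable_cst _)
    (fun w _ => h0' w) (measurable_funTS mh')).
  rewrite (_ : (\int[leb2]_(w in D) _)%E = (\int[leb2]_(w in D) (g w)%:E)%E); last first.
    apply: eq_integral => w; rewrite inE /D/= => wD.
    rewrite -EFinD; congr EFin; rewrite /h max_l; first by rewrite addrC subrK.
    rewrite subr_ge0 ler_expR lerN2.
    by move: wD; rewrite ltr_pdivlMr ?pi_gt0//; lra.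
  rewrite (@ge0_integral_lebesgue2 R); last 3 first.
  - exact: measurable_sqdist_lt.
  - by apply: measurable_funTS; apply/measurable_EFinP; exact: measurable_gauss2.
  - by move=> w _; rewrite lee_fin; exact: expR_ge0.
  have pi20 : 0 < pi / 2 :> R by rewrite divr_gt0 ?pi_gt0.
  rewrite [leLHS](integral_gauss_disk c pi20 s0) lee_fin /t.
  have p0 : pi != 0 :> R by rewrite gt_eqF ?pi_gt0.
  have -> : pi / 2 * (m / pi) = m / 2 by move: (pi : R) p0 => p p0; field.
  by have -> : pi / (pi / 2) = 2 :> R by move: (pi : R) p0 => p p0; field.
apply: le_trans int_h.
apply: (@le_trans _ _ (\int[leb2]_(w in A) (t%:E + (h w)%:E))%E).
  apply: ge0_le_integral.
  - exact: mA.
  - by move=> w _; rewrite lee_fin; exact: expR_ge0.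
  - by apply: measurable_funTS; exact/measurable_EFinP.
  - apply: measurable_funTS; apply: emeasurable_funD mh'.
    exact: measurable_cst.
  - by move=> w _; rewrite -EFinD lee_fin gh.
rewrite (ge0_integralD leb2 mA (fun _ _ => t0') (measurable_cst _)
  (fun w _ => h0' w) (measurable_funTS mh')).
apply: leeD.
  by rewrite (integral_cst leb2 mA) mulrC EFinM; exact: lee_wpmul2l.
exact: (ge0_subset_integral leb2 mA measurableT mh' (fun w _ => h0' w)).
Qed.

End Final.

(** * Double counting and conclusion *)

Section Main.
Context {R : realType}.
Local Notation R2 := (measurableTypeR R * measurableTypeR R)%type.
Local Notation leb2 := (lebesgue2 R).
Local Notation P := (plane R * plane R)%type.

Lemma measurable_coord1 : measurable_fun setT (fun w : plane R => w.1 : R).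
Proof. exact: (measurable_fun_from_borel measurable_fst). Qed.

Lemma measurable_coord2 : measurable_fun setT (fun w : plane R => w.2 : R).
Proof. exact: (measurable_fun_from_borel measurable_snd). Qed.

Lemma measurable_sqdist2 : measurable_fun setT (fun p : P => sqdist p.1 p.2).
Proof.
have m11 := measurableT_comp measurable_coord1 (@measurable_fst _ _ (plane R) (plane R)).
have m12 := measurableT_comp measurable_coord1 (@measurable_snd _ _ (plane R) (plane R)).
have m21 := measurableT_comp measurable_coord2 (@measurable_fst _ _ (plane R) (plane R)).
have m22 := measurableT_comp measurable_coord2 (@measurable_snd _ _ (plane R) (plane R)).
exact: (measurable_funD (measurable_funX 2 (measurable_funB m12 m11))
  (measurable_funX 2 (measurable_funB m22 m21))).
Qed.

Lemma sqdistC (z w : R2) : sqdist z w = sqdist w z.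
Proof. by rewrite /sqdist; ring. Qed.

(** Stated for booleans to keep unification from unfolding the sets involved.
    *)
Lemma indic_andb (a b : bool) (x : R) :
  (if a && b then x%:E else 0%E) = ((a%:R * b%:R) * x)%:E.
Proof. by case: a; case: b; rewrite /= ?mul1r ?mulr0 ?mul0r. Qed.

(** The kernel K(z, w) is V(w) times the Gaussian, restricted to z in Omega
    and |z - w| < r. Integrating it first in w bounds the left-hand side from
    above, by the local inequality; integrating it first in z gives the
    right-hand side, by the bathtub bound. *)
Lemma concentration (V : plane R -> R) (Omega : set (plane R)) (r k m : R) :
  measurable Omega -> measurable_fun setT V -> (forall w, 0 <= V w) ->
  0 < r -> 0 <= k ->
  (forall z, (k * V z)%:E <=
     \int[leb2]_(w in disk r z) (V w * expR (- (pi / 2 * sqdist z w)))%:E)%E ->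
  (forall w, leb2 (Omega `&` disk r w) <= m%:E)%E ->
  (k%:E * \int[leb2]_(z in Omega) (V z)%:E <=
   (2 * (1 - expR (- (m / 2))))%:E * \int[leb2]_z (V z)%:E)%E.
Proof.
move=> mO mV V0 r0 k0 sub Om.
pose B : R := 2 * (1 - expR (- (m / 2))).
have m0 : 0 <= m by rewrite -lee_fin (le_trans _ (Om point)).
have B0 : 0 <= B.
  have e1 : expR (- (m / 2)) <= expR 0 by rewrite ler_expR oppr_le0 divr_ge0.
  by move: e1; rewrite /B expR0; lra.
pose D : set P := [set p | sqdist p.1 p.2 < r ^+ 2].
have mD : measurable D.
  have := measurable_sqdist2 measurableT (measurable_itv `]-oo, r ^+ 2[).
  by rewrite setTI; congr measurable; apply/seteqP; split => p /=; rewrite in_itv.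
pose G (p : P) := V p.2 * expR (- (pi / 2 * sqdist p.1 p.2)).
have mG : measurable_fun setT G.
  apply: (measurable_funM (measurableT_comp mV (@measurable_snd _ _ (plane R) (plane R)))).
  apply: (measurableT_comp (@measurable_expR R)); apply: measurable_funN.
  exact: (measurable_funM (measurable_cst (pi / 2)) measurable_sqdist2).
have G0 p : 0 <= G p by rewrite mulr_ge0 ?expR_ge0.
pose K (p : P) : \bar R := ((\1_Omega p.1 * \1_D p) * G p)%:E.
have K0 p : (0 <= K p)%E by rewrite lee_fin mulr_ge0// mulr_ge0.
have mK : measurable_fun setT K.
  apply/measurable_EFinP; apply: measurable_funM mG; apply: measurable_funM.
    exact: (measurableT_comp (measurable_indic mO) (@measurable_fst _ _ (plane R) (plane R))).
  exact: measurable_indic.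
have mVE : measurable_fun setT (fun w : plane R => (V w)%:E) by exact/measurable_EFinP.
have VE0 w : (0 <= (V w)%:E)%E by rewrite lee_fin.
have tonelli : (\int[leb2]_z \int[leb2]_w K (z, w) = \int[leb2]_w \int[leb2]_z K (z, w))%E.
  exact: (@fubini_tonelli _ _ _ _ R (@sigma_lebesgue2 R) (@sigma_lebesgue2 R) K mK K0).
have mKF : measurable_fun setT (fun z => \int[leb2]_w K (z, w))%E.
  exact: (@measurable_fun_fubini_tonelli_F _ _ _ _ R (@sigma_lebesgue2 R) K mK K0).
have mKG : measurable_fun setT (fun w => \int[leb2]_z K (z, w))%E.
  exact: (@measurable_fun_fubini_tonelli_G _ _ _ _ R (@sigma_lebesgue2 R) K mK K0).
have step1 : (k%:E * \int[leb2]_(z in Omega) (V z)%:E <=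
    \int[leb2]_z \int[leb2]_w K (z, w))%E.
  rewrite -(ge0_integralZl_EFin leb2 mO (fun w _ => VE0 w) (measurable_funTS mVE) k0).
  rewrite [leLHS]integral_mkcond; apply: ge0_le_integral.
  - exact: measurableT.
  - by move=> z _; apply: erestrict_ge0 => w _; rewrite mule_ge0// lee_fin.
  - apply/(measurable_restrictT _ mO).1; apply: measurable_funTS.
    exact: (measurable_funeM _ mVE).
  - exact: mKF.
  move=> z _; rewrite patchE; case: ifPn => [|_]; last exact: integral_ge0.
  rewrite inE => zO; rewrite -EFinM; apply: le_trans (sub z) _.
  rewrite [leLHS]integral_mkcond le_eqVlt; apply/orP; left; apply/eqP.
  apply: eq_integral => w _; rewrite patchE /K /= !indicE (mem_set zO).
  have -> : ((z, w) \in D) = (w \in disk r z) by apply/idP/idP; rewrite !inE.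
  by rewrite -(indic_andb true).
have step2 w : (\int[leb2]_z K (z, w) <= B%:E * (V w)%:E)%E.
  have mOD : measurable (Omega `&` disk r w) by apply: measurableI mO (measurable_disk r w).
  have -> : (\int[leb2]_z K (z, w) = \int[leb2]_(z in Omega `&` disk r w)
      ((V w)%:E * (expR (- (pi / 2 * sqdist w z)))%:E))%E.
    rewrite [RHS]integral_mkcond; apply: eq_integral => z _.
    rewrite patchE /K /= !indicE in_setI.
    have -> : ((z, w) \in D) = (z \in disk r w).
      by apply/idP/idP; rewrite !inE /D /disk/= -!/(sqdist _ _) sqdistC.
    by rewrite -EFinM indic_andb /G sqdistC.
  rewrite (ge0_integralZl_EFin leb2 mOD _ _ (V0 w)).
  - rewrite muleC; apply: lee_wpmul2r; first exact: VE0.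
    exact: bathtub mOD (Om w).
  - by move=> z _; rewrite lee_fin expR_ge0.
  - apply: measurable_funTS; apply/measurable_EFinP.
    by apply: measurable_fun_from_borel; exact: measurable_gauss2.
apply: (le_trans step1); rewrite tonelli.
rewrite -(ge0_integralZl_EFin leb2 measurableT (fun w _ => VE0 w) mVE B0).
apply: ge0_le_integral.
- exact: measurableT.
- by move=> w _; apply: integral_ge0.
- exact: mKG.
- exact: (measurable_funeM _ mVE).
- by move=> w _; exact: step2.
Qed.

End Main.

Theorem mainTheorem3 (R : realType) (Omega : set (plane R)) (r : R)
    (mOmega : measurable Omega) (r_gt0 : 0 < r)
    (f : (R -> complex R) -> complex R)
    (f_M1 : M1 f) (f_neq0 : nonzero_distribution f) :
  (\int[lebesgue2 R]_(z in Omega) Normc.normc (stft (@h0 R) f z)) /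
  (\int[lebesgue2 R]_(z in setT) Normc.normc (stft (@h0 R) f z))
  <= 2 * (1 - expR (- (fine (nu Omega r) / 2))) / (1 - expR (- (pi * r ^+ 2))).
Proof.
have [tf [iRe iIm]] := f_M1.
pose V (w : plane R) := Normc.normc (stft (@h0 R) f w).
have mRe : measurable_fun setT (fun w : plane R => complex.Re (stft (@h0 R) f w)).
  by apply/measurable_EFinP; exact: measurable_int iRe.
have mIm : measurable_fun setT (fun w : plane R => complex.Im (stft (@h0 R) f w)).
  by apply/measurable_EFinP; exact: measurable_int iIm.
have mV : measurable_fun setT V.
  have -> : V = fun w => Num.sqrt (complex.Re (stft (@h0 R) f w) ^+ 2 +
      complex.Im (stft (@h0 R) f w) ^+ 2).
    by apply/funext => w; rewrite /V; case: stft.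
  apply: (measurableT_comp (@measurable_sqrt R)).
  exact: (measurable_funD (measurable_funX 2 mRe) (measurable_funX 2 mIm)).
have V0 w : 0 <= V w by exact: normc_ge0.
have VE0 w : (0 <= (V w)%:E)%E by rewrite lee_fin.
have mVE : measurable_fun setT (fun w => (V w)%:E) by exact/measurable_EFinP.
pose T := (\int[lebesgue2 R]_z (V z)%:E)%E.
pose S := (\int[lebesgue2 R]_(z in Omega) (V z)%:E)%E.
have T_fin : T \is a fin_num.
  have := integrable_fin_num measurableT (integrableD measurableT (integrable_abse iRe) (integrable_abse iIm)).
  set U := (\int[_]_(_ in _) _)%E => U_fin.
  rewrite ge0_fin_numE; last exact: integral_ge0.
  apply: (@le_lt_trans _ _ U); last first.
    rewrite -ge0_fin_numE; first exact: U_fin.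
    by rewrite /U; apply: integral_ge0 => w _; exact: (adde_ge0 (abse_ge0 _) (abse_ge0 _)).
  apply: ge0_le_integral.
  - exact: measurableT.
  - by move=> w _; exact: VE0.
  - exact: mVE.
  - apply: emeasurable_funD.
      exact: (measurable_int _ (integrable_abse iRe)).
    exact: (measurable_int _ (integrable_abse iIm)).
  - by move=> w _; rewrite /= -EFinD lee_fin; exact: normc_le_reim.
have ST : (S <= T)%E.
  exact: (ge0_subset_integral (lebesgue2 R) mOmega measurableT mVE (fun w _ => VE0 w)).
have S0 : (0 <= S)%E by exact: integral_ge0.
have S_fin : S \is a fin_num.
  by rewrite ge0_fin_numE// (le_lt_trans ST)// -ge0_fin_numE// (le_trans S0).
have nu_le : (nu Omega r <= (pi * r ^+ 2)%:E)%E.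
  apply: ge_ereal_sup => _ [z _ <-].
  rewrite -(lebesgue2_disk z r_gt0); apply: le_measure.
  - by rewrite inE; exact: measurableI mOmega (measurable_disk r z).
  - by rewrite inE; exact: measurable_disk.
  - exact: subIsetr.
have nu_ub (w : plane R) : (lebesgue2 R (Omega `&` disk r w) <= nu Omega r)%E.
  by apply: ereal_sup_ubound; exists w.
have nu0 : (0 <= nu Omega r)%E by apply: le_trans (nu_ub point).
have nu_fin : nu Omega r \is a fin_num.
  by rewrite ge0_fin_numE// (le_lt_trans nu_le)// ltry.
have k_gt0 : 0 < 1 - expR (- (pi * r ^+ 2)).
  by rewrite subr_gt0 -(@expR0 R) ltr_expR oppr_lt0 mulr_gt0 ?pi_gt0 ?exprn_gt0.
have := @concentration R V Omega r _ (fine (nu Omega r)) mOmega mV V0 r_gt0 (ltW k_gt0).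
move=> /(_ (fun z => stft_submean z tf r_gt0 mV)).
rewrite fineK// => /(_ nu_ub).
rewrite -/S -/T -(fineK S_fin) -(fineK T_fin) -!EFinM lee_fin => main.
rewrite /Rintegral -/S -/T.
have B0 : 0 <= 2 * (1 - expR (- (fine (nu Omega r) / 2))).
  have e1 : expR (- (fine (nu Omega r) / 2)) <= expR 0.
    by rewrite ler_expR oppr_le0 divr_ge0// fine_ge0.
  by move: e1; rewrite expR0; lra.
(* If T = 0 the quotient is 0, as the inverse of 0 is 0. *)
have : 0 <= fine T by apply: fine_ge0; exact: le_trans ST.
rewrite le_eqVlt => /predU1P[<-|T_gt0].
  by rewrite invr0 mulr0 divr_ge0// ltW.
by rewrite ler_pdivrMr// mulrAC ler_pdivlMr// mulrC.
Qed.
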